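(* Let $l\in\mathbb{Z}$ with $l\neq 0$ and let $\alpha$ be an irrational number with $v(2\pi\alpha)=0$. Then there exists a function $f\in\mathcal{F}_l$ such that, for $T:\mathbb{T}^2\to\mathbb{T}^2$, $T(x,y)=(x+\alpha,f(x)+y)$, the system $(\mathbb{T}^2,T)$ is minimal and distal but is not a system of order $2$, and moreover the following holds: there exist $\epsilon_0>0$ and functions $c_1,c_2:(0,\epsilon_0)\to(0,+\infty)$ such that for every $\epsilon\in(0,\epsilon_0)$ $$c_1(\epsilon)\,n\le r(n,\epsilon)\le c_2(\epsilon)\,n\quad\text{for every integer } n\ge 1,$$ and $c_1(\epsilon)\to+\infty$ as $\epsilon\to 0$.
   Context: $\mathbb{T}^1=\mathbb{R}/\mathbb{Z}$ and $\mathbb{T}^2=\mathbb{T}^1\times\mathbb{T}^1$ carries the metric $d((x_1,y_1),(x_2,y_2))=\max\{\|x_1-x_2\|,\|y_1-y_2\|\}$, where $\|r-s\|=\min_{m\in\mathbb{Z}}|r-s+m|$ (so $\|t\|$ is the distance from $t$ to the nearest integer). For a real number $\beta$, $v(\beta)=\liminf_{n\to+\infty}n\|n\beta\|$. For $l\in\mathbb{Z}$, $\mathcal{F}_l=\{h:\mathbb{R}\to\mathbb{R}: h\text{ continuous and } h(x+1)-h(x)=l\text{ for all }x\in\mathbb{R}\}$; for $f\in\mathcal{F}_l$ the value $f(x)$ mod $1$ is well defined for $x\in\mathbb{T}^1$. For $n\ge1$ put $d_n(u,v)=\max_{0\le i\le n-1}d(T^iu,T^iv)$. A set $F\subset\mathbb{T}^2$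 is $(n,\epsilon)$-spanning if for every $u\in\mathbb{T}^2$ there is $v\in F$ with $d_n(u,v)\le\epsilon$; $r(n,\epsilon)$ is the smallest cardinality of an $(n,\epsilon)$-spanning set. A topological dynamical system is a pair $(X,T)$ with $X$ a compact metric space and $T:X\to X$ a homeomorphism; it is minimal if every orbit is dense, and distal if $\inf_{n\in\mathbb{Z}}d(T^nx,T^ny)>0$ whenever $x\ne y$. If $G$ is a $d$-step nilpotent Lie group (i.e. $G_{d+1}$ is trivial, where $G_1=G$, $G_{j+1}=[G_j,G]$), $\Gamma$ is a discrete cocompact subgroup of $G$ and $\tau\in G$, then $X=G/\Gamma$ with the map $x\mapsto\tau x$ is called a $d$-step nilsystem. A minimal topological dynamical system is a system of order $d$ if it is an inverse limit of $d$-step nilsystems. *)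

(* Defs.v *)
From HB Require Import structures.
From mathcomp Require Import all_boot all_order all_algebra.
From mathcomp Require Import finmap generic_quotient ring_quotient.
From mathcomp Require Import all_classical all_reals all_analysis.
From mathcomp Require Import ring lra.

Set Implicit Arguments.
Unset Strict Implicit.
Unset Printing Implicit Defensive.

Import Order.TTheory GRing.Theory Num.Theory.
Import numFieldNormedType.Exports.

Local Open Scope classical_set_scope.
Local Open Scope ring_scope.

Section NearestInteger.
Variable R : realType.
Implicit Types x y t : R.

(* ||t||; the infimum is attained, see [nint_distP]. *)
Definition nint_dist t : R := inf [set `|t + m%:~R| | m in [set: int]].

Definition diophantine_liminf (beta : R) : \bar R :=
  limn_einf (fun n => (n%:R * nint_dist (n%:R * beta))%:E).

Lemma nint_dist_le t (m : int) : nint_dist t <= `|t + m%:~R|.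
Proof.
apply: ge_inf; last by exists m.
by exists 0 => _ [k _ <-].
Qed.

Lemma nint_distP t : exists m : int, nint_dist t = `|t + m%:~R|.
Proof.
pose m0 : int := - Num.floor (t + 2^-1).
have half : `|t + m0%:~R| <= 2^-1.
  have /andP[h1 h2] := floor_itv (t + 2^-1).
  move: h1 h2; rewrite /m0 intrD rmorphN /= => h1 h2.
  by rewrite ler_norml; apply/andP; split; lra.
exists m0; apply/eqP; rewrite eq_le nint_dist_le /=.
apply: lb_le_inf; first by exists `|t + m0%:~R|; exists m0.
move=> _ [m _ <-].
have [->//|mm0] := eqVneq m m0.
have h1 : 1 <= `|(m - m0)%:~R : R|.
  by rewrite norm_intr_ge1 ?intr_int// intr_eq0 subr_eq0.
have h2 : `|(m - m0)%:~R : R| <= `|t + m%:~R| + `|t + m0%:~R|.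
  rewrite intrD rmorphN /=.
  have -> : m%:~R - m0%:~R = (t + m%:~R) - (t + m0%:~R) :> R by ring.
  exact: ler_normB.
lra.
Qed.

End NearestInteger.

Section Circle.
Variable R : realType.

Definition int_subgroup : zmodClosed R :=
  GRing.ZmodClosed.clone R (@Num.int_num_subdef R) _.

Definition circle : Type := Quotient.quot int_subgroup.

HB.instance Definition _ := EqQuotient.on circle.
HB.instance Definition _ := GRing.Zmodule.on circle.

Definition to_circle (x : R) : circle := (\pi_(Quotient.quot int_subgroup) x)%qT.

Lemma to_circleD : {morph to_circle : x y / x + y}.
Proof. by move=> x y; rewrite /to_circle !piE. Qed.

Lemma to_circleN : {morph to_circle : x / - x}.
Proof. by move=> x; rewrite /to_circle !piE. Qed.

Lemma to_circleE (x y : R) :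
  to_circle x = to_circle y <-> exists m : int, x = y + m%:~R.
Proof.
have E : (x - y \in int_subgroup) = (to_circle x == to_circle y).
  by rewrite Quotient.idealrBE.
split=> [/eqP|[m xy]].
  rewrite -E => /intrP[m xy]; exists m; rewrite -xy; ring.
by apply/eqP; rewrite -E; apply/intrP; exists m; rewrite xy; ring.
Qed.

Lemma repr_circleK (u : circle) : to_circle (repr u) = u.
Proof. by rewrite /to_circle reprK. Qed.

Lemma repr_to_circle (x : R) : exists m : int, repr (to_circle x) = x + m%:~R.
Proof. by apply/to_circleE; rewrite repr_circleK. Qed.

Definition circle_dist (u w : circle) : R := nint_dist (repr u - repr w).

Lemma nint_distD_int (t : R) (m : int) : nint_dist (t + m%:~R) = nint_dist t.
Proof.
apply/eqP; rewrite eq_le; apply/andP; split.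
  have [k ->] := nint_distP t.
  rewrite (le_trans (nint_dist_le _ (k - m)))// intrD rmorphN /=.
  by rewrite (_ : t + _ + _ = t + k%:~R)//; ring.
have [k ->] := nint_distP (t + m%:~R).
by rewrite (le_trans (nint_dist_le _ (m + k)))// intrD addrA.
Qed.

Lemma circle_distE (x y : R) :
  circle_dist (to_circle x) (to_circle y) = nint_dist (x - y).
Proof.
rewrite /circle_dist; have [m ->] := repr_to_circle x.
have [k ->] := repr_to_circle y.
rewrite -(nint_distD_int (x - y) (m - k)) intrD rmorphN /=; congr nint_dist; ring.
Qed.

Lemma nint_distD (s t : R) : nint_dist (s + t) <= nint_dist s + nint_dist t.
Proof.
have [m ->] := nint_distP s; have [k ->] := nint_distP t.
rewrite (le_trans (nint_dist_le _ (m + k)))// intrD.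
by rewrite (_ : _ + _ + _ = (s + m%:~R) + (t + k%:~R)) ?ler_normD//; ring.
Qed.

Lemma nint_distN (t : R) : nint_dist (- t) = nint_dist t.
Proof.
have le s : nint_dist (- s) <= nint_dist s.
  have [m ->] := nint_distP s.
  by rewrite (le_trans (nint_dist_le _ (- m)))// rmorphN -opprD normrN.
by apply/eqP; rewrite eq_le le -{1}(opprK t) le.
Qed.

Let circle_distxx u : circle_dist u u = 0.
Proof.
rewrite /circle_dist subrr; apply/eqP; rewrite eq_le.
by have := nint_dist_le (0 : R) 0; have [m ->] := nint_distP (0 : R);
  rewrite addr0 normr0 normr_ge0 => ->.
Qed.

Let circle_dist_positivity u w : circle_dist u w = 0 -> u = w.
Proof.
rewrite -[u]repr_circleK -[w]repr_circleK circle_distE => h.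
have [m hm] := nint_distP (repr u - repr w); apply/to_circleE; exists (- m).
move: hm; rewrite h => /esym/normr0_eq0; rewrite rmorphN /= => e; lra.
Qed.

Let circle_dist_sym u w : circle_dist u w = circle_dist w u.
Proof. by rewrite /circle_dist -nint_distN opprB. Qed.

Let circle_dist_triangle w u z :
  circle_dist u z <= circle_dist u w + circle_dist w z.
Proof.
rewrite /circle_dist (_ : repr u - repr z =
  (repr u - repr w) + (repr w - repr z)) ?nint_distD//; ring.
Qed.

HB.instance Definition _ := isMetric.Build R circle
  circle_distxx circle_dist_positivity circle_dist_sym circle_dist_triangle.

End Circle.

Section ProductMetric.
Variables (R : realType) (M N : metricType R).

Let dist (u w : M * N) : R := Num.max (mdist u.1 w.1) (mdist u.2 w.2).

Let dist_ge0 u w : 0 <= dist u w.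
Proof. by rewrite le_max mdist_ge0. Qed.

Let dist_positivity u w : dist u w = 0 -> u = w.
Proof.
move=> h; have : dist u w <= 0 by rewrite h.
rewrite ge_max => /andP[h1 h2]; case: u w h h1 h2 => [a b] [c d] /= _ h1 h2.
by congr pair; apply: mdist_positivity; apply/eqP; rewrite eq_le mdist_ge0 andbT.
Qed.

Let ballEdist (u : M * N) d : ball u d = [set w | dist u w < d].
Proof.
rewrite /ball /= /prod_ball !ballEmdist; apply/seteqP.
by split=> w /=; rewrite gt_max => /andP.
Qed.

HB.instance Definition _ := PseudoMetric_isMetric.Build R (M * N)%type
  dist_ge0 dist_positivity ballEdist.

End ProductMetric.

Section Dynamics.

Record homeo (X : topologicalType) := Homeo {
  homeo_fun :> X -> X;
  homeo_inv : X -> X;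
  homeo_funK : cancel homeo_fun homeo_inv;
  homeo_invK : cancel homeo_inv homeo_fun;
  homeo_fun_continuous : continuous homeo_fun;
  homeo_inv_continuous : continuous homeo_inv }.

Definition iterz (X : topologicalType) (T : homeo X) (n : int) : X -> X :=
  match n with
  | Posz k => iter k T
  | Negz k => iter k.+1 (homeo_inv T)
  end.

Definition minimal (X : topologicalType) (T : homeo X) : Prop :=
  forall x, dense [set iterz T n x | n in [set: int]].

Definition distal (R : realType) (X : metricType R) (T : homeo X) : Prop :=
  forall x y, x != y ->
    0 < inf [set mdist (iterz T n x) (iterz T n y) | n in [set: int]].

(* The maximum over i < n for n >= 1; the default value 0 is then irrelevant,
   distances being nonnegative. *)
Definition bowen_dist (R : realType) (X : metricType R) (T : X -> X) (n : nat)
    (u w : X) : R :=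
  \big[Num.max/0]_(i < n) mdist (iter i T u) (iter i T w).

Definition spanning (R : realType) (X : metricType R) (T : X -> X) (n : nat)
    (eps : R) (F : {fset X}) : Prop :=
  forall u, exists2 w, w \in F & bowen_dist T n u w <= eps.

(* Extended-real valued: +oo when there is no finite spanning set; otherwise
   the infimum is attained, being over a nonempty set of natural numbers. *)
Definition span_card (R : realType) (X : metricType R) (T : X -> X) (n : nat)
    (eps : R) : \bar R :=
  ereal_inf [set (#|` F|%:R)%:E | F in [set F : {fset X} | spanning T n eps F]].

Definition factor_map (X Y : topologicalType) (T : X -> X) (S : Y -> Y)
    (p : X -> Y) : Prop :=
  [/\ continuous p, (forall y, exists x, p x = y) & forall x, p (T x) = S (p x)].

Definition inverse_limit (Y : nat -> topologicalType)
    (p : forall i, Y i.+1 -> Y i) : set (prod_topology Y) :=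
  [set y | forall i, p i (y i.+1) = y i].

(* [T] is topologically conjugate, through [h], to (y_i)_i |-> (S_i y_i)_i on
   the inverse limit of a sequence of factor maps. *)
Definition is_inverse_limit (X : topologicalType) (T : X -> X)
    (Y : nat -> topologicalType) (S : forall i, Y i -> Y i) : Prop :=
  exists p : forall i, Y i.+1 -> Y i,
    (forall i, factor_map (S i.+1) (S i) (p i)) /\
    exists (h : X -> prod_topology Y) (g : prod_topology Y -> X),
      [/\ continuous h, {within inverse_limit p, continuous g},
          range h = inverse_limit p, cancel h g
        & forall x i, h (T x) i = S i (h x i)].

End Dynamics.

Section Smooth.
Variable R : realType.

Fixpoint Ck (k n m : nat) (U : set 'rV[R]_n) (F : 'rV[R]_n -> 'rV[R]_m) : Prop :=
  {within U, continuous F} /\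
  if k is k'.+1 then
    forall i : 'I_n,
      (forall x, U x -> derivable F x (delta_mx 0 i)) /\
      Ck k' U (fun x => 'D_(delta_mx 0 i) F x)
  else True.

(* C^oo on [U]; only meaningful for [U] open. *)
Definition smooth_on (n m : nat) (U : set 'rV[R]_n) (F : 'rV[R]_n -> 'rV[R]_m) :=
  forall k, Ck k U F.

Record chart (n : nat) (M : topologicalType) := Chart {
  chart_dom : set M;
  chart_fun :> M -> 'rV[R]_n;
  chart_inv : 'rV[R]_n -> M;
  chart_dom_open : open chart_dom;
  chart_cod_open : open (chart_fun @` chart_dom);
  chart_fun_continuous : {within chart_dom, continuous chart_fun};
  chart_inv_continuous : {within chart_fun @` chart_dom, continuous chart_inv};
  chart_funK : forall x, chart_dom x -> chart_inv (chart_fun x) = x }.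

Definition chart_cod (n : nat) (M : topologicalType) (a : chart n M) :
  set 'rV[R]_n := a @` chart_dom a.

Definition smooth_atlas (n : nat) (M : topologicalType) (A : set (chart n M)) :
    Prop :=
  (forall x, exists2 a, A a & chart_dom a x) /\
  forall a b, A a -> A b ->
    smooth_on [set z | chart_cod a z /\ chart_dom b (chart_inv a z)]
              (fun z => b (chart_inv a z)).

End Smooth.

#[short(type="preTopologicalGroupType")]
HB.structure Definition PreTopologicalGroup := {G of Group G & Topological G}.

Section LieGroup.
Variable R : realType.

(* The product manifold G x G is read in 'rV_(n + n) through pairs of charts. *)
Record lieGroup := LieGroup {
  lie_sort :> preTopologicalGroupType;
  lie_dim : nat;
  lie_atlas : set (chart R lie_dim lie_sort);
  lie_hausdorff : hausdorff_space lie_sort;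
  lie_second_countable : @second_countable lie_sort;
  lie_atlasP : smooth_atlas lie_atlas;
  lie_mul_continuous : continuous (fun u : lie_sort * lie_sort => (u.1 * u.2)%g);
  lie_inv_continuous : continuous (fun x : lie_sort => x^-1%g);
  lie_mul_smooth : forall a b c, lie_atlas a -> lie_atlas b -> lie_atlas c ->
    smooth_on
      [set z : 'rV[R]_(lie_dim + lie_dim) |
        [/\ chart_cod a (lsubmx z), chart_cod b (rsubmx z)
          & chart_dom c (chart_inv a (lsubmx z) * chart_inv b (rsubmx z))%g]]
      (fun z => c (chart_inv a (lsubmx z) * chart_inv b (rsubmx z))%g);
  lie_inv_smooth : forall a b, lie_atlas a -> lie_atlas b ->
    smooth_on
      [set z | chart_cod a z /\ chart_dom b (chart_inv a z)^-1%g]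
      (fun z => b (chart_inv a z)^-1%g) }.

End LieGroup.

Section Nilpotent.
Variable G : groupType.

Definition subgroup (H : set G) : Prop :=
  H 1%g /\ forall x y, H x -> H y -> H (x * y^-1)%g.

(* Indexed from 0: [lower_central j] is G_{j+1}. *)
Fixpoint lower_central (j : nat) : set G :=
  if j is k.+1 then
    smallest subgroup
      [set z | exists x y, lower_central k x /\ z = [~ x, y]%g]
  else setT.

Definition nilpotent_of_step (d : nat) : Prop := lower_central d = [set 1%g].

End Nilpotent.

Section CosetSpace.
Variables (G : preTopologicalGroupType) (Gamma : groupClosed G).

Definition same_lcoset (x y : G) : bool := (x^-1 * y)%g \in Gamma.

Lemma same_lcoset_equiv : equiv_class_of same_lcoset.
Proof.
split=> [x|x y|y x z]; rewrite /same_lcoset.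
- by rewrite mulVg gpred1.
- by rewrite -gpredV invgM invgK.
- by move=> xy yz; rewrite -(mulgK y x^-1%g) -[X in X \in _]mulgA gpredM.
Qed.

Canonical same_lcoset_equiv_rel := EquivRelPack same_lcoset_equiv.
Canonical same_lcoset_encModRel := defaultEncModRel same_lcoset.

(* G / Gamma with the quotient topology *)
Definition coset_space : Type := quotient_topology {eq_quot same_lcoset}%qT.

HB.instance Definition _ := Topological.on coset_space.

Definition coset_translation (tau : G) (x : coset_space) : coset_space :=
  (\pi_(quotient_topology {eq_quot same_lcoset}%qT) (tau * repr x)%g)%qT.

Definition discrete_subgroup : Prop :=
  forall x, x \in Gamma ->
    exists2 U : set G, open U & U `&` [set y | y \in Gamma] = [set x].

Definition cocompact : Prop := compact [set: coset_space].

End CosetSpace.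

Section Nilsystem.
Variable R : realType.

Record nilsystem (d : nat) := Nilsystem {
  nil_group : lieGroup R;
  nil_lattice : groupClosed nil_group;
  nil_elt : nil_group;
  nil_nilpotent : nilpotent_of_step nil_group d;
  nil_discrete : discrete_subgroup nil_lattice;
  nil_cocompact : cocompact nil_lattice }.

Definition nil_space (d : nat) (N : nilsystem d) : topologicalType :=
  coset_space (nil_lattice N).

Definition nil_map (d : nat) (N : nilsystem d) : nil_space N -> nil_space N :=
  @coset_translation _ (nil_lattice N) (nil_elt N).

Definition system_of_order (d : nat) (X : topologicalType) (T : homeo X) : Prop :=
  minimal T /\
  exists N : nat -> nilsystem d,
    @is_inverse_limit X T (fun i => nil_space (N i)) (fun i => @nil_map d (N i)).

End Nilsystem.

Section SkewProduct.
Variable R : realType.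

Definition calF (l : int) : set (R -> R) :=
  [set h : R -> R | continuous h /\ forall x, h (x + 1) - h x = l%:~R].

Lemma calF_int l h : calF l h -> forall x (m : int),
  exists k : int, h (x + m%:~R) = h x + k%:~R.
Proof.
move=> [_ hl].
have H1 x : h (x + 1) = h x + l%:~R by rewrite -(hl x); ring.
have Hn x (n : nat) : exists k : int, h (x + n%:R) = h x + k%:~R.
  elim: n => [|n [k IH]]; first by exists 0; rewrite !addr0.
  by exists (k + l); rewrite -natr1 addrA H1 IH intrD addrA.
move=> x [n|n]; first exact: Hn.
have [k Hk] := Hn (x + (Negz n)%:~R) n.+1.
exists (- k); move: Hk; rewrite (_ : x + _ + _ = x); last first.
  by rewrite NegzE rmorphN /=; ring.
by move=> ->; rewrite rmorphN /=; ring.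
Qed.

Definition circle_map (f : R -> R) (u : circle R) : circle R :=
  to_circle (f (repr u)).

Lemma circle_mapE l f : calF l f -> forall x,
  circle_map f (to_circle x) = to_circle (f x).
Proof.
move=> hf x; have [m hm] := repr_to_circle x.
by apply/to_circleE; rewrite hm; exact: (calF_int hf).
Qed.

Lemma to_circle_near (x : R) (u : circle R) :
  exists y, u = to_circle y /\ `|x - y| = mdist (to_circle x) u.
Proof.
rewrite -(repr_circleK u) [mdist _ _]circle_distE.
have [m hm] := nint_distP (x - repr u).
exists (repr u - m%:~R); split.
  by apply/to_circleE; exists m; ring.
by rewrite hm; congr `|_|; ring.
Qed.

Lemma mdist_to_circle_le (x y : R) :
  mdist (to_circle x) (to_circle y) <= `|x - y|.
Proof.
rewrite [mdist _ _]circle_distE.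
by have := nint_dist_le (x - y) 0; rewrite addr0.
Qed.

Lemma to_circle_continuous : continuous (@to_circle R).
Proof.
move=> x; apply/metricType_numDomainType.cvgrPdist_lt => e e0.
near=> y; apply: le_lt_trans (mdist_to_circle_le _ _) _.
by near: y; exact: (@cvgr_dist_lt _ R R (nbhs x) _ id x).
Unshelve. all: by end_near. Qed.

Lemma circle_map_continuous l f : calF l f -> continuous (circle_map f).
Proof.
move=> hf u; rewrite -(repr_circleK u); set x := repr u.
apply/(@metricType_numDomainType.cvgrPdist_lt _ _ _ _ (nbhs_filter _)) => e e0.
have /cvgrPdist_lt/(_ e e0)/nbhs_ballP[d /= d0 hd] := hf.1 x.
apply/nbhs_ballP; exists d => //= w; rewrite ballEmdist /= => hw.
have [y [wE hy]] := to_circle_near x w; subst w.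
rewrite !(circle_mapE hf); apply: le_lt_trans (mdist_to_circle_le _ _) _.
by apply: (hd y); rewrite /ball /= hy.
Qed.

Lemma circleD_continuous :
  continuous (fun p : circle R * circle R => p.1 + p.2).
Proof.
move=> [a b]; apply/(@metricType_numDomainType.cvgrPdist_lt _ _ _ _ (nbhs_filter _)) => e e0.
apply/nbhs_ballP; exists (e / 2) => /=.
  by rewrite divr_gt0.
move=> [c d]; rewrite ballEmdist /= [mdist (a, b) _]/(Num.max _ _) gt_max /= => /andP[h1 h2].
suff: mdist (a + b) (c + d) <= mdist a c + mdist b d by lra.
rewrite -[a]repr_circleK -[b]repr_circleK -[c]repr_circleK -[d]repr_circleK.
rewrite -!to_circleD ![mdist _ _]circle_distE.
rewrite (_ : _ - _ = (repr a - repr c) + (repr b - repr d)) ?nint_distD//; ring.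
Qed.

Lemma circleN_continuous : continuous (fun u : circle R => - u).
Proof.
move=> a; apply/(@metricType_numDomainType.cvgrPdist_lt _ _ _ _ (nbhs_filter _)) => e e0.
apply/nbhs_ballP; exists e => //= c; rewrite ballEmdist /=.
rewrite -[a]repr_circleK -[c]repr_circleK -!to_circleN ![mdist _ _]circle_distE.
by rewrite -[in X in _ -> X]nint_distN opprD !opprK.
Qed.

Definition skew (alpha : R) (f : R -> R) (u : circle R * circle R) :
    circle R * circle R :=
  (u.1 + to_circle alpha, circle_map f u.1 + u.2).

Definition skew_inv (alpha : R) (f : R -> R) (u : circle R * circle R) :
    circle R * circle R :=
  (u.1 - to_circle alpha, u.2 - circle_map f (u.1 - to_circle alpha)).

Lemma skewK alpha f : cancel (skew alpha f) (skew_inv alpha f).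
Proof. by case=> x y; rewrite /skew /skew_inv /= addrK addrC addKr. Qed.

Lemma skew_invK alpha f : cancel (skew_inv alpha f) (skew alpha f).
Proof. by case=> x y; rewrite /skew /skew_inv /= subrK addrC subrK. Qed.

Let continuousD (X : topologicalType) (g h : X -> circle R) :
  continuous g -> continuous h -> continuous (fun x => g x + h x).
Proof.
move=> cg ch x.
apply: (@continuous_comp _ _ _ (fun x => (g x, h x)) (fun p => p.1 + p.2)).
  exact: cvg_pair (cg x) (ch x).
exact: circleD_continuous.
Qed.

Lemma skew_continuous alpha l f : calF l f -> continuous (skew alpha f).
Proof.
move=> hf u.
have c1 : continuous (fun u : circle R * circle R => u.1 + to_circle alpha).
  by apply: continuousD => w; [exact: cvg_fst|exact: cvg_cst].
have c2 : continuous (fun u : circle R * circle R => circle_map f u.1 + u.2).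
  apply: continuousD => w; last exact: cvg_snd.
  apply: (@continuous_comp _ _ _ fst (circle_map f)); first exact: cvg_fst.
  exact: circle_map_continuous hf _.
exact: cvg_pair (c1 u) (c2 u).
Qed.

Lemma skew_inv_continuous alpha l f : calF l f -> continuous (skew_inv alpha f).
Proof.
move=> hf u.
have c1 : continuous (fun u : circle R * circle R => u.1 - to_circle alpha).
  by apply: continuousD => w; [exact: cvg_fst|exact: cvg_cst].
have c2 : continuous (fun u : circle R * circle R =>
    u.2 - circle_map f (u.1 - to_circle alpha)).
  apply: continuousD => w; first exact: cvg_snd.
  apply: (@continuous_comp _ _ _
    (circle_map f \o (fun u => u.1 - to_circle alpha)) (fun y => - y)).
    apply: continuous_comp; [exact: c1|exact: circle_map_continuous hf _].
  exact: circleN_continuous.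
exact: cvg_pair (c1 u) (c2 u).
Qed.

Definition skew_homeo (alpha : R) (l : int) (f : R -> R) (hf : calF l f) :
    homeo (circle R * circle R)%type :=
  Homeo (skewK alpha f) (skew_invK alpha f)
    (@skew_continuous alpha _ _ hf) (@skew_inv_continuous alpha _ _ hf).

Lemma torus_compact : compact [set: circle R * circle R].
Proof.
have c1 : compact [set: circle R].
  rewrite (_ : setT = @to_circle R @` `[0, 1]).
    apply: continuous_compact; last exact: segment_compact.
    by apply: continuous_subspaceT; exact: to_circle_continuous.
  apply/seteqP; split=> // u _; exists (repr u - (Num.floor (repr u))%:~R) => /=.
    have /andP[h1 h2] := floor_itv (repr u).
    by move: h2; rewrite intrD => h2; rewrite in_itv /=; apply/andP; split; lra.
  rewrite -[RHS]repr_circleK; apply/to_circleE.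
  by exists (- Num.floor (repr u)); rewrite rmorphN.
by rewrite -setXTT; exact: compact_setX.
Qed.

End SkewProduct.

(* Main.v *)
Require Import Defs.
From mathcomp Require Import all_boot all_order all_algebra.
From mathcomp Require Import finmap generic_quotient.
From mathcomp Require Import all_classical all_reals all_analysis.
From mathcomp Require Import ring lra zify.

Import Order.TTheory GRing.Theory Num.Theory.
Import numFieldNormedType.Exports.

Local Open Scope classical_set_scope.
Local Open Scope ring_scope.

(** The map is f(x) = l x + phi(x), where phi is the sum over j of the coboundaries
    g_j(x + alpha) - g_j(x) of the waves g_j(x) = ||q_j x|| / 4, along integers q_j
    that grow geometrically and satisfy q_j ||q_j alpha|| <= 1. A finite partial sum
    could be removed by a change of coordinates in the fibres; the whole series
    cannot, because at a time n with n ||q_k alpha|| close to 9/2 the k-th wave has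
    been shifted by half a period, so that the Birkhoff sum of phi oscillates by a
    fixed amount at the scale 1/q_k, for every k.

    Complexity. Nevertheless the Birkhoff sums of phi of order n vary by at most
    2 sqrt (n |x - y|) ([birkhoff_phi_holder]). Hence points at horizontal distance
    c / n stay close for n steps, and a grid of O(n) points is (n, eps)-spanning. In
    the other direction, the linear part n l (x - y) dominates the square root, so
    that two points of the same height at horizontal distance 7 / n are separated
    ([skew_separation]); with 1 / (6 eps) different heights this gives about
    n / (84 eps) separated points, and c1(eps) = 1 / (84 eps) tends to infinity.

    Minimality is Furstenberg's theorem ([stab_full]): the orbit closures meet each
    fibre in a coset of a closed subgroup of the circle, and a proper subgroup would
    force the Birkhoff sums of f to grow by a bounded amount over a full turn,
    whereas they grow by n l. Distality holds because T is a fibrewise rotation over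
    a rotation.

    Order 2. In an inverse limit of two-step nilsystems, two points that are
    regionally proximal of order 2 are equal ([order2_regionally_proximal2]): in
    G / Gamma commutators are central and bilinear, and so the last vertex of a
    cube is determined by the other ones ([two_step_cube]). On the torus
    the oscillation of phi produces such a pair of distinct points
    ([twisted_regionally_proximal2]): in the fibres over 0 and over a nearby xi one
    finds points at a height difference t away from 0 whose orbits meet again both
    at time n and at time 2 n. *)

(** * Distance to the nearest integer *)

Section NearestIntegerTheory.
Context {R : realType}.
Implicit Types (s t u : R).

Lemma nint_dist_ge0 t : 0 <= nint_dist t.
Proof. by have [m ->] := nint_distP t. Qed.

Lemma nint_dist_le_norm t : nint_dist t <= `|t|.
Proof. by have := nint_dist_le t 0; rewrite addr0. Qed.

Lemma nint_dist_le_half t : nint_dist t <= 2^-1.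
Proof.
have /andP[h1 h2] := floor_itv (t + 2^-1).
apply: le_trans (nint_dist_le t (- Num.floor (t + 2^-1))) _.
move: h1 h2; rewrite intrD rmorphN /= => h1 h2.
by rewrite ler_norml; apply/andP; split; lra.
Qed.

Lemma nint_dist_int (m : int) : nint_dist (m%:~R : R) = 0.
Proof.
by apply/eqP; rewrite eq_le nint_dist_ge0 andbT -[m%:~R]add0r nint_distD_int
  (le_trans (nint_dist_le_norm 0))// normr0.
Qed.

Lemma nint_dist0 : nint_dist (0 : R) = 0.
Proof. exact: (nint_dist_int 0). Qed.

Lemma nint_dist_small t : `|t| <= 2^-1 -> nint_dist t = `|t|.
Proof.
move=> ht; apply/eqP; rewrite eq_le nint_dist_le_norm /=.
have [m ->] := nint_distP t.
have [->|m0] := eqVneq m 0; first by rewrite addr0.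
have h1 : 1 <= `|m%:~R : R| by rewrite norm_intr_ge1 ?intr_int// intr_eq0.
have h2 : `|m%:~R : R| <= `|t + m%:~R| + `|t|.
  by have := ler_normB (t + m%:~R) t; rewrite (_ : t + _ - t = m%:~R)//; ring.
lra.
Qed.

Lemma nint_dist_lip s t : `|nint_dist s - nint_dist t| <= nint_dist (s - t).
Proof.
have h1 := nint_distD (s - t) t; rewrite subrK in h1.
have h2 := nint_distD (t - s) s.
have h3 := nint_distN (s - t); rewrite opprB in h3; rewrite subrK h3 in h2.
by rewrite ler_norml; apply/andP; split; lra.
Qed.

Lemma nint_dist_ge e t : e <= t <= 1 - e -> e <= nint_dist t.
Proof.
move=> /andP[h1 h2]; have [[m|m] ->] := nint_distP t.
  by apply: le_trans (ler_norm _); have : 0 <= (Posz m)%:~R :> R by []; lra.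
rewrite NegzE rmorphN /= -normrN; apply: le_trans (ler_norm _).
have : 1 <= m.+1%:~R :> R by rewrite ler1z.
lra.
Qed.

Lemma nint_dist_half t : nint_dist (t + 2^-1) = 2^-1 - nint_dist t.
Proof.
have [m hm] := nint_distP t; have := nint_dist_le_half t.
rewrite -(nint_distD_int (t + 2^-1) m) -addrA [2^-1 + _]addrC addrA hm.
case: (ler0P (t + m%:~R)) => h1 h2.
  rewrite nint_dist_small; last by rewrite ler_norml; apply/andP; split; lra.
  by rewrite ger0_norm; lra.
rewrite -(nint_distD_int _ (-1)) nint_dist_small.
  by rewrite ler0_norm rmorphN /=; lra.
by rewrite rmorphN ler_norml; apply/andP; split; rewrite /=; lra.
Qed.

Lemma nint_dist_mul (n : nat) t : nint_dist (n%:R * t) <= n%:R * nint_dist t.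
Proof.
elim: n => [|n IH]; first by rewrite !mul0r nint_dist0.
by rewrite -natr1 !mulrDl !mul1r (le_trans (nint_distD _ _))// lerD2r.
Qed.

(** Dirichlet: among the N + 1 fractional parts of 0, t, ..., N t two share one
    of the N boxes of length 1/N, and their indices differ by q. *)
Lemma dirichlet t (N : nat) : (0 < N)%N ->
  exists q : nat, [/\ (0 < q)%N, (q <= N)%N & nint_dist (q%:R * t) * N%:R < 1].
Proof.
move=> N0; pose fr (i : nat) := i%:R * t - (Num.floor (i%:R * t))%:~R.
have fr01 i : 0 <= fr i < 1.
  have /andP[h1 h2] := floor_itv (i%:R * t).
  by move: h2; rewrite /fr intrD => h2; apply/andP; split; lra.
have N0R : 0 < N%:R :> R by rewrite ltr0n.
have frN i : 0 <= N%:R * fr i < N%:R.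
  have /andP[h1 h2] := fr01 i.
  by rewrite gtr_pMr// h2 mulr_ge0// ltW.
have box i : (Num.truncn (N%:R * fr i) < N)%N.
  by have /andP[h1 h2] := frN i; rewrite truncn_lt_nat.
pose b (i : 'I_N.+1) := Ordinal (box i).
have [i [j [ij bij]]] : exists i j : 'I_N.+1, (i < j)%N /\ b i = b j.
  have : ~ injective b by move/leq_card; rewrite !card_ord ltnn.
  move=> /existsNP[i /existsNP[j /not_implyP[bij /eqP ij]]].
  case: (ltngtP i j) => [lt|lt|/val_inj e]; [by exists i, j|by exists j, i|].
  by rewrite e eqxx in ij.
exists (j - i)%N; split; first by rewrite subn_gt0.
  by rewrite (leq_trans (leq_subr _ _))// -ltnS.
move: bij => /(congr1 val) /= bij.
have /andP[ai _] := frN i; have /andP[aj _] := frN j.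
have /andP[i1 i2] := truncn_itv ai; have /andP[j1 j2] := truncn_itv aj.
rewrite bij in i1 i2; rewrite -natr1 in i2 j2.
have ltN : `|fr j - fr i| * N%:R < 1.
  rewrite -(ger0_norm (ltW N0R)) -normrM ltr_norml.
  by apply/andP; split; lra.
apply: le_lt_trans ltN; rewrite ler_pM2r//.
rewrite natrB; last exact: ltnW.
apply: le_trans (nint_dist_le _ (Num.floor (i%:R * t) - Num.floor (j%:R * t))) _.
rewrite intrD rmorphN le_eqVlt; apply/orP; left; apply/eqP; congr `|_|.
by rewrite /fr; ring.
Qed.

Lemma nint_dist_irrational (alpha : R) (n : nat) : irrational alpha -> (0 < n)%N ->
  0 < nint_dist (n%:R * alpha).
Proof.
move=> irr n0; rewrite lt_neqAle nint_dist_ge0 andbT eq_sym.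
apply/eqP => h; apply: irr; have [m] := nint_distP (n%:R * alpha).
rewrite h => /esym/normr0_eq0 e.
exists (- m%:~R / n%:R) => //.
have n0' : n%:R != 0 :> R by rewrite pnatr_eq0 -lt0n.
rewrite rmorphM rmorphN /= ratr_int fmorphV /= ratr_nat.
by apply: (mulIf n0'); rewrite mulfVK//; lra.
Qed.

(** Large good denominators exist with arbitrarily small defect: once N defeats
    the defects of all q < K, the q given by Dirichlet is at least K. *)
Lemma good_denominator (alpha : R) (K : nat) (e : R) : irrational alpha -> 0 < e ->
  exists q : nat, [/\ (K <= q)%N, (0 < q)%N, nint_dist (q%:R * alpha) < e
    & q%:R * nint_dist (q%:R * alpha) <= 1].
Proof.
move=> irr e0.
have [d d0 hd] : exists2 d : R, 0 < d &
    forall q, (0 < q < K)%N -> d <= nint_dist (q%:R * alpha).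
  elim: K => [|K [d d0 hd]]; first by exists 1 => // q; rewrite ltn0 andbF.
  have [K0|K0] := posnP K.
    by exists 1 => // q; rewrite K0 ltnS leqn0 lt0n => /andP[/negbTE->].
  exists (Num.min d (nint_dist (K%:R * alpha))).
    by rewrite lt_min d0 nint_dist_irrational.
  move=> q /andP[q0]; rewrite ltnS leq_eqVlt => /orP[/eqP->|qK].
    by rewrite ge_min lexx orbT.
  by rewrite ge_min hd// q0.
pose N := (Num.truncn (Num.min e d)^-1).+1.
have m0 : 0 < Num.min e d by rewrite lt_min e0.
have hN : 1 < Num.min e d * N%:R.
  by rewrite -ltr_pdivrMl// mulr1 truncnS_gt.
have [q [q0 qN hq]] := @dirichlet alpha N isT.
have lt : nint_dist (q%:R * alpha) < Num.min e d.
  by rewrite -(ltr_pM2r (_ : 0 < N%:R))//; apply: lt_trans hN.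
have /andP[lte ltd] : (nint_dist (q%:R * alpha) < e) && (nint_dist (q%:R * alpha) < d).
  by rewrite -lt_min.
exists q; split => //.
  by rewrite leqNgt; apply/negP => qK; have := hd q; rewrite q0 qK leNgt ltd => /(_ isT).
apply: le_trans (ltW hq); rewrite mulrC ler_wpM2l ?nint_dist_ge0//.
by rewrite ler_nat.
Qed.

(** The multiples of a number close to, but different from, an integer advance by
    steps shorter than e. *)
Lemma multiples_dense t e z : 0 < nint_dist t < e ->
  exists n : nat, nint_dist (n%:R * t - z) < e.
Proof.
move=> /andP[t0 te]; have [m hm] := nint_distP t.
set s := t + m%:~R in hm; rewrite hm in t0 te.
have s0 : s != 0 by rewrite -normr_gt0.
(* the multiples of s only reach the numbers on the same side of 0 *)
have [k hk] : exists k : int, 0 <= (z + k%:~R) / s.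
  case: (ltrgt0P s) => [sp|sn|e0]; last by rewrite e0 eqxx in s0.
    exists (- Num.floor z); rewrite divr_ge0 ?(ltW sp)//.
    by have := floor_itv z; rewrite rmorphN /= subr_ge0 => /andP[].
  exists (- Num.floor z - 1); rewrite -mulrNN -invrN mulr_ge0 ?oppr_ge0//.
    have /andP[_ h] := floor_itv z; move: h; rewrite !intrD !rmorphN /=; lra.
  by rewrite invr_le0 ltW.
set w := (z + k%:~R) / s in hk *; exists (Num.truncn w).
have /andP[n1 n2] := truncn_itv hk.
set n := Num.truncn w in n1 n2 *; rewrite -natr1 in n2.
apply: le_lt_trans te.
apply: le_trans (nint_dist_le _ (n%:Z * m - k)) _.
rewrite intrD rmorphN rmorphM /=.
have -> : n%:R * t - z + (n%:R * m%:~R - k%:~R) = s * (n%:R - w).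
  by rewrite mulrBr /w mulrCA divff// mulr1 /s; ring.
rewrite normrM ler_piMr ?normr_ge0// ler_norml; apply/andP; split; lra.
Qed.

End NearestIntegerTheory.

(** * Regional proximality in two-step nilsystems *)

Section TwoStepGroup.
Local Open Scope group_scope.
Context {G : groupType}.
(* The commutator is abstracted as br, so that rewriting with associativity
   cannot unfold it. *)
Context {br : G -> G -> G}.
Hypothesis brC : forall x y, x * y = y * x * br x y.
Hypothesis br_central : forall x y z : G, commute (br x y) z.
Implicit Types (x y z : G).

Lemma brMl x y z : br (x * y) z = br x z * br y z.
Proof.
apply: (mulgI (z * (x * y))); rewrite -brC.
rewrite -[LHS]mulgA [y * z]brC !mulgA [x * z]brC.
by rewrite -[z * x * _ * y]mulgA br_central !mulgA.
Qed.

Lemma brV x y : br x y * br y x = 1.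
Proof. by apply: (mulgI (y * x)); rewrite mulgA -brC -brC mulg1. Qed.

Lemma brMr x y z : br x (y * z) = br x y * br x z.
Proof.
rewrite -[LHS](mulgK (br (y * z) x)) brV mul1g brMl invgM.
have brI u v : (br u v)^-1 = br v u by apply: mulg1_eq; rewrite brV.
by rewrite !brI br_central.
Qed.

Lemma brxx x : br x x = 1.
Proof. by apply: (mulgI (x * x)); rewrite -brC mulg1. Qed.

Lemma br_br x y z : br x (br y z) = 1.
Proof. by apply: (mulgI (br y z * x)); rewrite -brC mulg1 br_central. Qed.

Lemma gpred_br (Gamma : groupClosed G) x y :
  x \in Gamma -> y \in Gamma -> br x y \in Gamma.
Proof.
move=> Gx Gy; have -> : br x y = (y * x)^-1 * (x * y) by rewrite [x * y]brC mulKg.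
by rewrite !gpredM ?gpredV ?gpredM.
Qed.

(** The last corner of a cube is determined by the others. The commutators of the
    c_i with k are, up to [Gamma], the commutators z_i of c_i with the small e_i,
    and k is congruent to z_i e_i. As c3 is c2 c1 times the bounded part B = y p,
    bilinearity gives z3 = z2 z1 [B, k]; and [B, k] is [B, e1] up to [Gamma],
    because k is congruent to the small e1 up to central elements. Comparing
    z3 e3 with z2 e2 bounds z1, hence k. *)
Lemma two_step_cube (Gamma : groupClosed G) k y p c1 c1' c2 c2' c3 c3' e1 e2 e3 :
  c1 \in Gamma -> c1' \in Gamma -> c2 \in Gamma -> c2' \in Gamma ->
  c3 \in Gamma -> c3' \in Gamma ->
  k = c1 * e1 * c1'^-1 -> k = c2 * e2 * c2'^-1 -> k = c3 * e3 * c3'^-1 ->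
  c3 = c2 * y * c1 * p ->
  (e1 * (br (y * p) e1)^-1 * e3^-1 * e2)^-1 * k \in Gamma.
Proof.
move=> G1 G1' G2 G2' G3 G3' k1 k2 k3 c3E.
have kz c e c' : k = c * e * c'^-1 -> k = br c e * e * (c * c'^-1).
  by move=> ->; rewrite [c * e]brC -!br_central !mulgA.
have kd c e c' : k = c * e * c'^-1 -> br c k = br c e * br c c'^-1.
  by move=> ->; rewrite !brMr brxx mul1g.
have CA u v w t : br u v * (w * t) = w * (br u v * t).
  by rewrite !mulgA [br u v * w]br_central.
pose b := br (y * p) e1.
pose z1 := br c1 e1; pose z2 := br c2 e2; pose z3 := br c3 e3.
pose g1 := c1 * c1'^-1.
have Gg1 : g1 \in Gamma by rewrite gpredM ?gpredV.
have [d [Gd dC] hd] : exists2 d, d \in Gamma /\ (forall x, commute d x) &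
    z3 = z2 * z1 * b * d.
  pose f := br c2 c2'^-1 * br c1 c1'^-1 * br (y * p) g1.
  have fE : f = br c2 c2'^-1 * br c1 c1'^-1 *
                ((br c2 g1)^-1 * br c3 g1 * (br c1 g1)^-1).
    congr (_ * _); rewrite c3E !brMl -!mulgA mulKg.
    by rewrite [br c1 g1 * _]mulgA [br c1 g1 * _]br_central mulgK.
  exists (f * (br c3 c3'^-1)^-1); first split.
  - by rewrite fE !gpredM ?gpredV ?gpred_br ?gpredV.
  - move=> x; apply: commute_sym.
    by rewrite /f; do 3?apply: commuteM; do ?apply: commuteV; apply: commute_sym.
  suff h3 : z3 * br c3 c3'^-1 = z2 * z1 * b * f by rewrite mulgA -h3 mulgK.
  rewrite -(kd _ _ _ k3) c3E !brMl -/z1 -/z2 (kd _ _ _ k2) (kd _ _ _ k1).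
  have kB x : br x k = br x e1 * br x g1.
    by rewrite {1}(kz _ _ _ k1) 2!brMr br_br mul1g.
  rewrite !kB /b /f -/z1 -/z2 !brMl.
  rewrite -!mulgA; congr (_ * _).
  rewrite (CA y g1 z1) (CA y e1 z1) (CA c2 _ z1) (CA c2 _ (br y e1)).
  by rewrite (CA c1 _ (br p e1)) !(CA _ _ (br p e1)) (CA y g1 (br c1 _)).
have e2E : e2 = z1 * b * e3 * (d * (c3 * c3'^-1) * (c2 * c2'^-1)^-1).
  apply: (mulgI z2); apply: (mulIg (c2 * c2'^-1)).
  rewrite -(kz _ _ _ k2) (kz _ _ _ k3) -/z3 hd -!mulgA; do 3 congr (_ * _).
  by rewrite mulVg mulg1 !mulgA dC.
have -> : k = e1 * b^-1 * e3^-1 * e2 * 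
            ((d * (c3 * c3'^-1) * (c2 * c2'^-1)^-1)^-1 * g1).
  rewrite e2E; move: (d * _ * _) => r.
  rewrite -!mulgA mulVKg {1}(kz _ _ _ k1) -!(CA _ _ e3^-1) mulKg.
  by rewrite -(CA _ _ b^-1) mulKg -CA !mulgA.
by rewrite mulKg !gpredM ?gpredV ?gpredM ?gpredV ?gpredM ?gpredV.
Qed.

End TwoStepGroup.

Section CosetSpaceTheory.
Context {G : preTopologicalGroupType} (Gamma : groupClosed G).
Hypothesis mul_continuous : continuous (fun u : G * G => (u.1 * u.2)%g).
Hypothesis inv_continuous : continuous (fun x : G => x^-1%g).

Definition coset_proj (g : G) : coset_space Gamma :=
  (\pi_(quotient_topology {eq_quot (same_lcoset Gamma)}%qT) g)%qT.

Lemma coset_projP g h : coset_proj g = coset_proj h <-> (g^-1 * h)%g \in Gamma.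
Proof. by split => [/eqmodP|?]; last exact/eqmodP. Qed.

Lemma coset_proj_repr x : coset_proj (repr x) = x.
Proof. exact: reprK. Qed.

Lemma coset_translation_proj t g :
  coset_translation t (coset_proj g) = coset_proj (t * g)%g.
Proof.
apply/coset_projP; rewrite invgM -mulgA mulKg.
by apply/coset_projP; rewrite coset_proj_repr.
Qed.

Lemma cvgMg {T : Type} {F : set_system T} {FF : Filter F} (f g : T -> G) a b :
  f @ F --> a -> g @ F --> b -> (f x * g x)%g @[x --> F] --> (a * b)%g.
Proof. move=> fa gb.
apply: (@continuous2_cvg _ _ _ _ F _ f g (fun x y => x * y)%g a b) fa gb.
exact: (mul_continuous (a, b)).
Qed.

Lemma cvgVg {T : Type} {F : set_system T} {FF : Filter F} (f : T -> G) a :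
  f @ F --> a -> (f x)^-1%g @[x --> F] --> a^-1%g.
Proof. by move=> fa; apply: continuous_cvg fa; exact: inv_continuous. Qed.

(** The projection onto the coset space is open. *)
Lemma nbhs_coset_proj (V : set G) (w : G) : nbhs 1%g V ->
  nbhs (coset_proj w) [set x | exists2 e, V e & coset_proj (e * w)%g = x].
Proof.
rewrite nbhsE => -[U [oU U1] UV].
apply: (@filterS _ _ _ [set x | exists2 e, U e & coset_proj (e * w)%g = x]).
  by move=> x [e Ue <-]; exists e => //; exact: UV.
apply: open_nbhs_nbhs; split; last by exists 1%g => //; rewrite mul1g.
rewrite /open /= /quotient_open.
rewrite [X in open X](_ : _ = \bigcup_(c in [set c | c \in Gamma])
   ((fun y => y * (c * w^-1))%g @^-1` U)); last first.
  apply/seteqP; split => [y [z Uz /coset_projP zy]|y [c Gc Uc]] /=.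
    exists (y^-1 * (z * w))%g => /=; last by rewrite !mulgA mulgV mul1g mulgK.
    by rewrite -gpredV invgM invgK.
  exists (y * (c * w^-1))%g => //.
  by apply/coset_projP; rewrite mulgA mulgVK invgM mulgVK gpredV.
apply: bigcup_open => c _; apply: open_comp => // y _.
by apply: (@cvgMg _ _ _ id (fun=> _)); [exact: cvg_id|exact: cvg_cst].
Qed.

(** Two elements of the subgroup that are close to a common limit differ by an
    element close to 1, hence are equal. *)
Lemma discrete_subgroup_closed : hausdorff_space G -> discrete_subgroup Gamma ->
  closed [set x | x \in Gamma].
Proof.
move=> hG dG; have [U oU U1] := dG 1%g gpred1.
move=> x clx /=.
have U1' : U 1%g by have : [set 1%g] (1%g : G) by []; rewrite -U1 => -[].
have [N nN NU] : exists2 N, nbhs x N & forall a b, N a -> N b -> U (a^-1 * b)%g.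
  have : (p.1^-1 * p.2)%g @[p --> (x, x)] --> (x^-1 * x)%g.
    by apply: cvgMg; [apply: cvgVg; exact: cvg_fst|exact: cvg_snd].
  rewrite mulVg => /(_ U (open_nbhs_nbhs (conj oU U1'))) [[P Q] [/= nP nQ] PQ].
  exists (P `&` Q); first exact: filterI.
  by move=> a b [Pa _] [_ Qb]; apply: (PQ (a, b)).
have [c [Gc Nc]] := clx _ nN.
apply: contrapT => nG.
have xc : x != c by apply/eqP => xc; apply: nG; rewrite xc.
rewrite open_hausdorff in hG.
have [[P Q] /= [xP cQ] [oP oQ /eqP PQ]] := hG x c xc.
have nP : nbhs x P by apply: open_nbhs_nbhs; split=> //; rewrite inE in xP.
have [d [Gd [Nd Pd]]] := clx _ (filterI nN nP).
have : (U `&` [set y | y \in Gamma]) (c^-1 * d)%g.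
  by split; [exact: NU|rewrite /= gpredM// gpredV].
rewrite U1 => /= e; have cd : d = c by rewrite -[LHS](mulVKg c) e mulg1.
have : (P `&` Q) c by split; [rewrite -cd|rewrite inE in cQ].
by rewrite PQ.
Qed.

(** The points g Gamma and h Gamma near g0 Gamma and h0 Gamma are carried close to
    each other by t^n, t^m and t^(n + m). By [two_step_cube] the quotient of g and h
    is, up to [Gamma], a word in factors from V; it tends to 1 with V. *)
Lemma two_step_coset_eq (t g0 h0 w1 w2 w3 : G) :
  (forall x y z : G, commute [~ x, y]%g z) -> closed [set x | x \in Gamma] ->
  (forall V, nbhs 1%g V -> exists g h n m, 
    [/\ exists2 a, V a & g = (a * g0)%g,
        exists2 b, V b & h = (b * h0)%g,
        forall f, f = g \/ f = h -> exists e c, [/\ V e, c \in Gamma &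
           (t ^+ n * f * c = e * w1)%g],
        forall f, f = g \/ f = h -> exists e c, [/\ V e, c \in Gamma &
           (t ^+ m * f * c = e * w2)%g] &
        forall f, f = g \/ f = h -> exists e c, [/\ V e, c \in Gamma &
           (t ^+ n * (t ^+ m * f) * c = e * w3)%g]]) ->
  coset_proj g0 = coset_proj h0.
Proof.
move=> ts cG hyp.
(* the small factors are collected in one sequence p, and convergence is taken
   along the sequences all of whose terms tend to 1 *)
pose F := filter_from (nbhs (1%g : G))
  (fun V => [set p : nat -> G | forall i, V (p i)]).
have FF : ProperFilter F.
  apply: filter_from_proper; last first.
    by move=> V /nbhs_singleton V1; exists (fun=> 1%g).
  apply: filter_from_filter; first by exists setT; exact: filterT.
  move=> V W nV nW; exists (V `&` W); first exact: filterI.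
  by move=> p /= h; split => i; have [] := h i.
have pF i : p i @[p --> F] --> (1%g : G).
  by move=> V nV; exists V => // p /=; apply.
pose E w (p : nat -> G) i := (w^-1 * (p i)^-1 * p i.+1 * w)%g.
have EF w i : E w p i @[p --> F] --> (1%g : G).
  have : E w p i @[p --> F] --> (w^-1 * 1^-1 * 1 * w)%g.
    rewrite /E; do !(exact: cvg_cst || exact: pF ||
      (apply: cvgVg; exact: pF) || apply: cvgMg).
  by rewrite invg1 !mulg1 mulVg.
pose y (p : nat -> G) := (w2^-1 * (p 4%N)^-1 * (p 0%N * g0))%g.
pose z (p : nat -> G) := (w1^-1 * (p 2%N)^-1 * p 6%N * w3)%g.
pose B (p : nat -> G) := (y p * z p)%g.
pose O (p : nat -> G) := 
  ((g0^-1 * h0)^-1 * (g0^-1 * (p 1%N)^-1 * p 0%N * g0 *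
    (E w1 p 2%N * [~ B p, E w1 p 2%N]^-1 * (E w3 p 6%N)^-1 * E w2 p 4%N)))%g.
have OF : O p @[p --> F] --> (g0^-1 * h0)^-1%g.
  pose b0 := (w2^-1 * 1^-1 * (1 * g0) * (w1^-1 * 1^-1 * 1 * w3))%g.
  have BF : B p @[p --> F] --> b0.
    by rewrite /B /y /z; do !(exact: cvg_cst || exact: pF ||
      (apply: cvgVg; exact: pF) || apply: cvgMg).
  have : O p @[p --> F] --> ((g0^-1 * h0)^-1 * (g0^-1 * 1^-1 * 1 * g0 *
    (1 * [~ b0, 1]^-1 * 1^-1 * 1)))%g.
    rewrite /O /commg /conjg.
    by do !(exact: cvg_cst || exact: pF || exact: EF || exact: BF ||
      apply: cvgMg || apply: cvgVg).
  by rewrite commg1 !invg1 !mulg1 mulVg mulg1.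
suff : (g0^-1 * h0)^-1%g \in Gamma by rewrite gpredV => /coset_projP.
apply: contrapT => nG.
have : nbhs (g0^-1 * h0)^-1%g (~` [set x | x \in Gamma]).
  by apply: open_nbhs_nbhs; split=> //; rewrite openC.
move=> /OF [V nV hV].
have [g [h [n [m [[a Va gE] [b Vb hE] H1 H2 H3]]]]] := hyp V nV.
have [e1 [c1 [V1 G1 q1]]] := H1 g (or_introl erefl).
have [e1' [c1' [V1' G1' q1']]] := H1 h (or_intror erefl).
have [e2 [c2 [V2 G2 q2]]] := H2 g (or_introl erefl).
have [e2' [c2' [V2' G2' q2']]] := H2 h (or_intror erefl).
have [e3 [c3 [V3 G3 q3]]] := H3 g (or_introl erefl).
have [e3' [c3' [V3' G3' q3']]] := H3 h (or_intror erefl).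
pose p := nth e3' [:: a; b; e1; e1'; e2; e2'; e3; e3'].
have /(hV p) : forall i, V (p i).
  by rewrite /p; do 8?case=> //=; move=> i; rewrite nth_nil.
apply => /=.
have key (u : G) e e' w c c' : (u * g * c = e * w)%g -> (u * h * c' = e' * w)%g ->
   (g^-1 * h = c * (w^-1 * e^-1 * e' * w) * c'^-1)%g.
  move=> ug uh; have -> : (w^-1 * e^-1 = (e * w)^-1)%g by rewrite invgM.
  rewrite -ug -[(_ * e' * w)%g]mulgA -uh !invgM !mulgA mulgV mul1g.
  by rewrite mulgK mulgVK.
have := @two_step_cube G commg (@commgC G) ts Gamma (g^-1 * h)%g (y p) (z p)
  c1 c1' c2 c2' c3 c3' (E w1 p 2%N) (E w2 p 4%N) (E w3 p 6%N) G1 G1' G2 G2' G3 G3'.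
move/(_ (key _ _ _ _ _ _ q1 q1') (key _ _ _ _ _ _ q2 q2')).
rewrite !mulgA in q3 q3'.
move/(_ (key _ _ _ _ _ _ q3 q3')).
have yE : y p = (c2^-1 * g^-1 * (t ^+ m)^-1 * g)%g.
  rewrite /y /p /= -gE; congr (_ * _)%g.
  by rewrite -[(w2^-1 * _)%g]invgM -q2 !invgM !mulgA.
have zE : z p = (c1^-1 * g^-1 * t ^+ m * g * c3)%g.
  rewrite /z /p /= -[(_ * w3)%g]mulgA -q3 -[(w1^-1 * _)%g]invgM -q1 !invgM.
  by rewrite -!mulgA mulKg.
have c3E : c3 = (c2 * y p * c1 * z p)%g.
  by rewrite yE zE !mulgA mulgV mul1g !mulgK mulgVK mulVg mul1g.
move/(_ c3E); rewrite -/(B p); set X := (X in X \in Gamma) => GX.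
suff -> : O p = X^-1%g by rewrite gpredV.
by rewrite /O /X gE hE !invgM !invgK !mulgA !mulgK.
Qed.

End CosetSpaceTheory.

(** The regionally proximal relation of order 2 on a compact space; the points w_i
    at which the two orbits meet are then obtained as limits. *)
Definition regionally_proximal2 {X : topologicalType} (T : X -> X) (u v : X) :
    Prop :=
  exists w1 w2 w3 : X, forall A B C1 C2 C3 : set X,
    nbhs u A -> nbhs v B -> nbhs w1 C1 -> nbhs w2 C2 -> nbhs w3 C3 ->
    exists u' v' n m, [/\ A u', B v' &
      forall z, z = u' \/ z = v' ->
        [/\ C1 (iter n T z), C2 (iter m T z) & C3 (iter (n + m) T z)]].

Lemma nilpotent2_commute (G : groupType) : nilpotent_of_step G 2 ->
  forall x y z : G, commute [~ x, y]%g z.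
Proof.
move=> nG x y z; apply/commgP/eqP.
have sub (C : set G) : C `<=` smallest (@subgroup G) C by move=> a Ca M [_ ]; apply.
have : lower_central (G := G) 2 [~ [~ x, y], z]%g.
  apply: (sub) => /=; exists [~ x, y]%g, z; split => //.
  by apply: (sub) => /=; exists x, y.
by rewrite nG.
Qed.

Lemma nilsystem_regionally_proximal2 (R : realType) (N : nilsystem R 2)
    (X : topologicalType) (T : X -> X) (q : X -> nil_space N) (u v : X) :
  continuous q -> (forall x, q (T x) = nil_map (q x)) ->
  regionally_proximal2 T u v -> q u = q v.
Proof.
move=> cq qT [w1 [w2 [w3 hw]]].
pose G := nil_group N; pose Gamma := nil_lattice N; pose t := nil_elt N.
have cM : continuous (fun u : G * G => (u.1 * u.2)%g) by exact: lie_mul_continuous.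
have cV : continuous (fun x : G => x^-1%g) by exact: lie_inv_continuous.
have qE x : q x = coset_proj Gamma (repr (q x)) by rewrite coset_proj_repr.
have qn n x g : q x = coset_proj Gamma g ->
    q (iter n T x) = coset_proj Gamma (t ^+ n * g)%g.
  move=> xg; elim: n => [|n IH]; first by rewrite mul1g.
  by rewrite iterS qT IH /nil_map coset_translation_proj expgS mulgA.
have qV V x : nbhs (1%g : G) V ->
    nbhs x (q @^-1` [set y | exists2 e, V e & coset_proj Gamma (e * repr (q x))%g = y]).
  by move=> nV; apply: cq; rewrite {1}qE; exact: nbhs_coset_proj.
rewrite (qE u) (qE v).
apply: (@two_step_coset_eq _ _ cM cV t _ _ (repr (q w1)) (repr (q w2)) (repr (q w3))).
- exact/nilpotent2_commute/nil_nilpotent.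
- apply: discrete_subgroup_closed => //; [exact: lie_hausdorff|exact: nil_discrete].
move=> V nV.
have [u' [v' [n [m [[a Va aE] [b Vb bE] H]]]]] :=
  hw _ _ _ _ _ (qV V u nV) (qV V v nV) (qV V w1 nV) (qV V w2 nV) (qV V w3 nV).
have lift x g k w : q x = coset_proj Gamma g ->
    (exists2 e, V e & coset_proj Gamma (e * repr (q w))%g = q (iter k T x)) ->
    exists e c, [/\ V e, c \in Gamma & (t ^+ k * g * c = e * repr (q w))%g].
  move=> xg [e Ve]; rewrite (qn _ _ _ xg) => /esym/coset_projP kP.
  by exists e; eexists; split; [|exact: kP|rewrite mulVKg].
exists (a * repr (q u))%g, (b * repr (q v))%g, n, m; split.
- by exists a.
- by exists b.
- move=> f [->|->]; [apply: (lift u')|apply: (lift v')] => //.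
    by have [] := H u' (or_introl erefl).
  by have [] := H v' (or_intror erefl).
- move=> f [->|->]; [apply: (lift u')|apply: (lift v')] => //.
    by have [] := H u' (or_introl erefl).
  by have [] := H v' (or_intror erefl).
- move=> f; rewrite mulgA -expgnDr => -[->|->]; [apply: (lift u')|apply: (lift v')] => //.
    by have [] := H u' (or_introl erefl).
  by have [] := H v' (or_intror erefl).
Qed.

Lemma order2_regionally_proximal2 (R : realType) (X : topologicalType)
    (T : homeo X) (u v : X) :
  system_of_order R 2 T -> regionally_proximal2 T u v -> u = v.
Proof.
move=> [_ [N [p [_ [h [g [ch _ _ hK hT]]]]]]] uv.
apply: (can_inj hK); apply: functional_extensionality_dep => i.
apply: (@nilsystem_regionally_proximal2 R (N i) X T (fun x => h x i)) uv.
  move=> x; apply: (@continuous_comp _ _ _ h (fun y => y i)); first exact: ch.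
  exact: proj_continuous.
by move=> x; rewrite hT.
Qed.

(** * The rough cocycle and its Birkhoff sums *)

Section Birkhoff.
Context {R : realType} (alpha : R).

Definition birkhoff (h : R -> R) (n : nat) (x : R) : R :=
  \sum_(i < n) h (x + i%:R * alpha).

Lemma birkhoff0 h x : birkhoff h 0 x = 0.
Proof. by rewrite /birkhoff big_ord0. Qed.

Lemma birkhoffS h n x : birkhoff h n.+1 x = birkhoff h n x + h (x + n%:R * alpha).
Proof. by rewrite /birkhoff big_ord_recr. Qed.

Lemma birkhoffD h n m x :
  birkhoff h (n + m) x = birkhoff h n x + birkhoff h m (x + n%:R * alpha).
Proof.
elim: m => [|m IH]; first by rewrite addn0 birkhoff0 addr0.
by rewrite addnS !birkhoffS IH natrD -!addrA; congr (_ + (_ + h _)); ring.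
Qed.

End Birkhoff.

(** The potential 4 - 2/r takes over from r once the sequence has crossed 1. *)
Lemma sum_min_inv_le (R : realFieldType) (r : nat -> R) (J : nat) :
  (forall j, 0 < r j) -> (forall j, 2 * r j <= r j.+1) ->
  \sum_(j < J) Num.min (r j) (r j)^-1 <= 4.
Proof.
move=> r0 r2.
suff : \sum_(j < J) Num.min (r j) (r j)^-1 <=
    if r J <= 1 then r J else 4 - 2 * (r J)^-1.
  have i0 : 0 < (r J)^-1 by rewrite invr_gt0.
  by case: ifP => rJ h; apply: le_trans h _; lra.
elim: J => [|J IH].
  rewrite big_ord0; have rJ0 := r0 0%N; case: ifPn => [_|]; first exact: ltW.
  rewrite -ltNge => h; have := @invf_lt1 _ (r 0%N) rJ0; rewrite h; lra.
rewrite big_ord_recr /=; have := r2 J; have rJ := r0 J; have rJ' := r0 J.+1.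
have i0 : 0 < (r J)^-1 by rewrite invr_gt0.
have : Num.min (r J) (r J)^-1 <= r J by rewrite ge_min lexx.
have : Num.min (r J) (r J)^-1 <= (r J)^-1 by rewrite ge_min lexx orbT.
set M := Num.min _ _ => hM1 hM2 hr; move: IH.
case: (boolP (r J <= 1)) => h1 hS; case: ifPn => h2.
- lra.
- have h3 : 1 < r J.+1 by rewrite ltNge.
  have := @invf_lt1 _ (r J.+1) rJ'; rewrite h3; lra.
- lra.
- have : (r J.+1)^-1 <= (2 * r J)^-1 by rewrite lef_pV2// posrE; lra.
  by rewrite invfM; lra.
Qed.

Section Resonance.
Context {R : realType} (alpha : R) (q : nat -> nat).

Definition defect (j : nat) : R := nint_dist ((q j)%:R * alpha).

(** The factor 64 makes the frequencies q_j with j < k add up to at most q_k / 63,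
    so that the slower waves are nearly constant at the scale 1/q_k; the factor 512
    makes the faster waves nearly motionless up to the time 9 / (2 d_k), at which the
    k-th wave is shifted by half a period. *)
Definition resonant_sequence : Prop :=
  forall j, [/\ (0 < q j)%N, (64 * q j <= q j.+1)%N, (q j)%:R * defect j <= 1,
    0 < defect j <= 64^-1 & 512 * defect j.+1 <= defect j].

End Resonance.

Lemma resonant_sequence_exists (R : realType) (alpha : R) : irrational alpha ->
  exists q, resonant_sequence alpha q.
Proof.
move=> irr.
have /choice[F HF] : forall p, exists p', (0 < p)%N ->
    [/\ (64 * p <= p')%N, (0 < p')%N,
        512 * nint_dist (p'%:R * alpha) <= nint_dist (p%:R * alpha) &
        p'%:R * nint_dist (p'%:R * alpha) <= 1].
  move=> p; have [->|p0] := posnP p; first by exists 0%N.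
  have e0 : 0 < nint_dist (p%:R * alpha) / 512.
    by apply: divr_gt0; [exact: nint_dist_irrational|rewrite ltr0n].
  have [p' [h1 h2 h3 h4]] := @good_denominator _ alpha (64 * p) _ irr e0.
  by exists p' => _; split=> //; lra.
have e0 : 0 < 64^-1 :> R by rewrite invr_gt0.
have [q0 [_ h2 h3 h4]] := @good_denominator _ alpha 0 _ irr e0.
pose q j := iter j F q0.
have H j : [/\ (0 < q j)%N, nint_dist ((q j)%:R * alpha) <= 64^-1 &
    (q j)%:R * nint_dist ((q j)%:R * alpha) <= 1].
  elim: j => [|j [IH1 IH2 IH3]]; first by split=> //; exact: ltW.
  have [a b c d] := HF _ IH1; split=> //=.
  have := nint_dist_ge0 ((F (q j))%:R * alpha); rewrite -/(q j); lra.
exists q => j; have [a b c] := H j; have [a' b' c' d'] := HF _ a.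
by split=> //; rewrite /defect nint_dist_irrational.
Qed.

Section ResonantCocycle.
Context {R : realType} {alpha : R} {q : nat -> nat}.
Hypothesis hq : resonant_sequence alpha q.

Notation d := (defect alpha q).
Notation S := (birkhoff alpha).

Let q_gt0 j : 0 < (q j)%:R :> R.
Proof. by have [h _ _ _ _] := hq j; rewrite ltr0n. Qed.

Let q_grow j : 64 * (q j)%:R <= (q j.+1)%:R :> R.
Proof. by have [_ h _ _ _] := hq j; rewrite -natrM ler_nat. Qed.

Let d_gt0 j : 0 < d j.
Proof. by have [_ _ _ /andP[]] := hq j. Qed.

Let d_small j : d j <= 64^-1.
Proof. by have [_ _ _ /andP[]] := hq j. Qed.

Let d_decay j : 512 * d j.+1 <= d j.
Proof. by have [] := hq j. Qed.

Let d_leV j : d j <= (q j)%:R^-1.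
Proof. by have [_ _ h _ _] := hq j; rewrite -[leRHS]mul1r ler_pdivlMr// mulrC. Qed.

Lemma resonant_ge j : j.+1%:R <= (q j)%:R :> R.
Proof.
elim: j => [|j IH]; first by have [] := hq 0; rewrite ler_nat.
by have := q_grow j; have := ler0n R j; rewrite -[j.+2%:R]natr1 -natr1 in IH *; lra.
Qed.

Lemma defect_lt (e : R) : 0 < e -> exists J, d J < e.
Proof.
move=> e0; exists (Num.truncn e^-1).
apply: le_lt_trans (d_leV _) _; rewrite invf_plt ?posrE//.
by apply: lt_le_trans (resonant_ge _); exact: truncnS_gt.
Qed.

Definition wave (j : nat) (x : R) : R := nint_dist ((q j)%:R * x) / 4.

Definition transfer (J : nat) (x : R) : R := \sum_(j < J) wave j x.

(** The partial sums of the series of coboundaries, lowered by [d J], increase with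
    J, and their supremum is the sum of the series. *)
Definition phi (x : R) : R :=
  sup (range (fun J => transfer J (x + alpha) - transfer J x - d J)).

Lemma wave_lip j x y : `|wave j x - wave j y| <= (q j)%:R * `|x - y| / 4.
Proof.
rewrite /wave -mulrBl normrM (@ger0_norm _ 4^-1) ?invr_ge0//.
rewrite ler_pM2r ?invr_gt0//; apply: le_trans (nint_dist_lip _ _) _.
rewrite -mulrBr; apply: le_trans (nint_dist_le_norm _) _.
by rewrite normrM ger0_norm ?ler0n.
Qed.

Lemma wave_shift j n x : `|wave j (x + n%:R * alpha) - wave j x| <= n%:R * d j / 4.
Proof.
rewrite /wave -mulrBl normrM (@ger0_norm _ 4^-1) ?invr_ge0//.
rewrite ler_pM2r ?invr_gt0//; apply: le_trans (nint_dist_lip _ _) _.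
by rewrite -mulrBr addrC addKr mulrCA nint_dist_mul.
Qed.

Lemma wave_int j x (m : int) : wave j (x + m%:~R) = wave j x.
Proof.
by rewrite /wave mulrDr (_ : _ * m%:~R = ((q j)%:Z * m)%:~R) ?nint_distD_int// rmorphM.
Qed.

Lemma transfer_step J x :
  `|(transfer J.+1 (x + alpha) - transfer J.+1 x) - (transfer J (x + alpha) - transfer J x)|
    <= d J / 4.
Proof.
rewrite /transfer !big_ord_recr /=; have := wave_shift J 1 x; rewrite !mul1r.
by apply: le_trans; rewrite le_eqVlt; apply/orP; left; apply/eqP; congr `|_|; ring.
Qed.

(** The terms of the series decrease geometrically, being at most [d j / 4]. *)
Lemma phi_approx J x :
  `|phi x - (transfer J (x + alpha) - transfer J x)| <= d J.
Proof.
pose u J := transfer J (x + alpha) - transfer J x.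
have st j : - (d j / 4) <= u j.+1 - u j <= d j / 4.
  by rewrite -ler_norml; exact: transfer_step.
have lo i k : u i - d i <= u (i + k)%N - d (i + k)%N.
  elim: k => [|k IH]; first by rewrite addn0.
  rewrite addnS; apply: le_trans IH _.
  have := st (i + k)%N; have := d_decay (i + k)%N; have := d_gt0 (i + k)%N; lra.
have hi i k : u (i + k)%N + d (i + k)%N <= u i + d i.
  elim: k => [|k IH]; first by rewrite addn0.
  rewrite addnS; apply: le_trans IH.
  have := st (i + k)%N; have := d_decay (i + k)%N; have := d_gt0 (i + k)%N; lra.
have lohi i k : u i - d i <= u k + d k.
  have := lo i k; have := hi k i; rewrite addnC; have := d_gt0 (i + k)%N; lra.
have h1 : u J - d J <= phi x.
  apply: ub_le_sup; last by exists J.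
  by exists (u 0%N + d 0%N) => _ [i _ <-]; exact: lohi.
have h2 : phi x <= u J + d J.
  by apply: ge_sup; [exists (u 0%N - d 0%N), 0%N|move=> _ [i _ <-]; exact: lohi].
by rewrite -/(u J) ler_norml; apply/andP; split; lra.
Qed.

Lemma birkhoff_phi_approx J n x :
  `|S phi n x - (transfer J (x + n%:R * alpha) - transfer J x)| <= n%:R * d J.
Proof.
elim: n => [|n IH]; first by rewrite birkhoff0 !mul0r addr0 !subrr normr0.
have := phi_approx J (x + n%:R * alpha).
have -> : x + n%:R * alpha + alpha = x + n.+1%:R * alpha by rewrite -natr1; ring.
rewrite birkhoffS; move: IH; rewrite !ler_norml -natr1 => /andP[a b] /andP[e f].
by apply/andP; split; lra.
Qed.

Lemma phi_int x (m : int) : phi (x + m%:~R) = phi x.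
Proof.
congr sup; apply/seteqP; split=> _ [J _ <-]; exists J => //;
  by congr (_ - _ - _); apply: eq_bigr => j _; rewrite -?[x + _ + alpha]addrA
    -?[m%:~R + alpha]addrC ?addrA wave_int.
Qed.

Let nd_small (n : nat) (e : R) : 0 < e -> exists J, n%:R * d J <= e.
Proof.
move=> e0; have [J hJ] := @defect_lt (e / n.+1%:R) (divr_gt0 e0 (ltr0Sn _ n)).
exists J; apply: (@le_trans _ _ (n.+1%:R * d J)).
  by rewrite ler_wpM2r ?(ltW (d_gt0 _))// ler_nat.
by rewrite mulrC -ler_pdivlMr ?ltr0Sn// ltW.
Qed.

(** A wave of frequency q_j changes by at most q_j |x - y|, and its coboundary of
    order n is at most n / q_j: with q_j growing geometrically, the smaller of the
    two bounds is summable, uniformly in n. *)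
Lemma birkhoff_phi_holder n x y s : 0 < s -> n%:R * `|x - y| <= s ^+ 2 ->
  `|S phi n x - S phi n y| <= 2 * s.
Proof.
move=> s0 hs; have [->|xy] := eqVneq x y; first by rewrite subrr normr0; lra.
apply/ler_addgt0Pr => e e0.
have e2 : 0 < e / 2 by lra.
have [J hJ] := nd_small n _ e2.
have := birkhoff_phi_approx J n x; have := birkhoff_phi_approx J n y.
have D0 : 0 < `|x - y| by rewrite normr_gt0 subr_eq0.
have : `|(transfer J (x + n%:R * alpha) - transfer J x) -
         (transfer J (y + n%:R * alpha) - transfer J y)| <= 2 * s.
  rewrite -!sumrB; apply: le_trans (ler_norm_sum _ _ _) _.
  pose r j := (q j)%:R * `|x - y| / s.
  have r0 j : 0 < r j by rewrite divr_gt0 ?mulr_gt0.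
  have r2 j : 2 * r j <= r j.+1.
    rewrite /r !mulrA ler_pM2r ?invr_gt0// ler_pM2r//.
    by have := q_grow j; have := q_gt0 j; lra.
  apply: (@le_trans _ _ (\sum_(j < J) s / 2 * Num.min (r j) (r j)^-1)); last first.
    by rewrite -mulr_sumr; have := sum_min_inv_le _ _ J r0 r2; nra.
  apply: ler_sum => j _; rewrite minr_pMr; last by lra.
  rewrite le_min; apply/andP; split.
    have -> : s / 2 * r j = (q j)%:R * `|x - y| / 2 by rewrite /r; field; exact: lt0r_neq0.
    have := wave_lip j x y.
    have := wave_lip j (x + n%:R * alpha) (y + n%:R * alpha).
    rewrite (_ : x + _ - (y + _) = x - y); last by ring.
    rewrite !ler_norml => /andP[? ?] /andP[? ?]; apply/andP; split; lra.
  have h : n%:R * d j <= s * (r j)^-1.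
    apply: (@le_trans _ _ (n%:R / (q j)%:R)); first by rewrite ler_wpM2l ?d_leV.
    rewrite /r invf_div mulrA -expr2 ler_pdivlMr ?mulr_gt0//.
    by rewrite mulrA mulfVK ?gt_eqF.
  have := wave_shift j n x; have := wave_shift j n y.
  rewrite !ler_norml => /andP[? ?] /andP[? ?]; apply/andP; split; lra.
rewrite !ler_norml => /andP[? ?] /andP[? ?] /andP[? ?]; apply/andP; split; lra.
Qed.

Variable l : int.

Definition twisted (x : R) : R := l%:~R * x + phi x.

Lemma birkhoff_twisted n x y :
  S twisted n x - S twisted n y = n%:R * l%:~R * (x - y) + (S phi n x - S phi n y).
Proof.
elim: n => [|n IH]; first by rewrite !birkhoff0 !mul0r !subrr addr0.
rewrite !birkhoffS opprD addrACA IH /twisted -natr1; ring.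
Qed.

Lemma phi_continuous : continuous phi.
Proof.
move=> x; apply/cvgrPdist_le => e e0.
have e2 : 0 < (e / 2) ^+ 2 by rewrite exprn_gt0 ?divr_gt0.
near=> y.
have : 1%:R * `|x - y| <= (e / 2) ^+ 2.
  by rewrite mul1r ltW//; near: y; exact: (@cvgr_dist_lt _ R R (nbhs x) _ id x).
move=> /(birkhoff_phi_holder _ _ _ _ (divr_gt0 e0 (ltr0Sn _ 1))).
by rewrite !birkhoffS !birkhoff0 !add0r !mul0r !addr0; lra.
Unshelve. all: by end_near. Qed.

Lemma twisted_calF : calF l twisted.
Proof.
split=> [x|x].
  apply: continuousD; last exact: phi_continuous.
  by apply: continuousM; [exact: cst_continuous|exact: cvg_id].
by rewrite /twisted (phi_int x 1); ring.
Qed.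

Lemma birkhoff_continuous h n : continuous h -> continuous (S h n).
Proof.
move=> ch; elim: n => [|n IH] x.
  by rewrite (_ : S h 0 = cst 0); [exact: cst_continuous|apply/funext => y; rewrite birkhoff0].
rewrite (_ : S h n.+1 = (fun y => S h n y + h (y + n%:R * alpha))); last first.
  by apply/funext => y; rewrite birkhoffS.
apply: continuousD; first exact: IH.
apply: (@continuous_comp _ _ _ (fun y => y + n%:R * alpha) h); last exact: ch.
by apply: continuousD; [exact: cvg_id|exact: cst_continuous].
Qed.

Section ResonantTime.
Variable k : nat.

(** A shift by 9/2 is half a period modulo integers, like a shift by 1/2, but takes
    long enough for n to exceed 4 q_k. *)
Definition resonant_time : nat := Num.truncn (9 / (2 * d k)).

Notation n := resonant_time.
Notation N := nint_dist.

Let n_bounds : 9 / 2 - d k <= n%:R * d k <= 9 / 2.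
Proof.
have h0 : 0 <= 9 / (2 * d k) by rewrite divr_ge0// mulr_ge0// ltW.
have /andP[h1 h2] := truncn_itv h0; rewrite -/n in h1 h2.
rewrite ler_pdivlMr ?mulr_gt0// in h1.
rewrite ltr_pdivrMr ?mulr_gt0// -natr1 in h2.
by apply/andP; split; lra.
Qed.

Let n_large : 4 * (q k)%:R <= n%:R :> R.
Proof.
have /andP[h1 h2] := n_bounds; have [_ _ h _ _] := hq k.
rewrite -(ler_pM2r (d_gt0 k)); have := d_small k; lra.
Qed.

Let phase : N (n%:R * (q k)%:R * alpha - 2^-1) <= 64^-1.
Proof.
have [m hm] := nint_distP ((q k)%:R * alpha).
have /andP[h1 h2] := n_bounds; have := d_small k => h3.
have : (q k)%:R * alpha = d k - m%:~R \/ (q k)%:R * alpha = - d k - m%:~R.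
  rewrite /defect hm; case: (ler0P ((q k)%:R * alpha + m%:~R)) => _; [right|left]; ring.
rewrite -mulrA => -[->|->].
  apply: le_trans (nint_dist_le _ (n%:Z * m - 4)) _.
  rewrite intrD rmorphN rmorphM /= ler_norml.
  by apply/andP; split; lra.
apply: le_trans (nint_dist_le _ (n%:Z * m + 5)) _.
rewrite intrD rmorphM /= ler_norml.
by apply/andP; split; lra.
Qed.

Let shift_phase u : `|N (u + n%:R * (q k)%:R * alpha) - (2^-1 - N u)| <= 64^-1.
Proof.
rewrite -nint_dist_half; apply: le_trans (nint_dist_lip _ _) _.
by apply: le_trans phase; rewrite (_ : u + _ - _ = n%:R * (q k)%:R * alpha - 2^-1)//; ring.
Qed.

Let sum_q : 63 * (\sum_(j < k) (q j)%:R) <= (q k)%:R :> R.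
Proof.
elim: k => [|i IH]; first by rewrite big_ord0 mulr0 ltW.
by rewrite big_ord_recr /=; have := q_grow i; lra.
Qed.

(** At the resonant time the k-th wave is shifted by half a period, so that its
    coboundary is as large as the wave itself. The slower waves hardly vary over
    the distances considered, and the faster ones have not yet moved. *)
Lemma resonant_increment x xi : 0 <= xi -> xi <= 3 / (4 * (q k)%:R) ->
  `|(S phi n (x + xi) - S phi n x) -
    (N ((q k)%:R * x) - N ((q k)%:R * x + (q k)%:R * xi)) / 2| <= 30^-1.
Proof.
move=> xi0 xi1.
have nd : n%:R * d k.+1 <= 9 / 1024.
  have /andP[_ h] := n_bounds; have := d_decay k; have := ler0n R n; nra.
have slow y : `|transfer k (y + xi) - transfer k y| <= 336^-1.
  rewrite -sumrB; apply: le_trans (ler_norm_sum _ _ _) _.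
  apply: (@le_trans _ _ (\sum_(j < k) (q j)%:R * (xi / 4))).
    apply: ler_sum => j _; apply: le_trans (wave_lip _ _ _) _.
    by rewrite [y + xi]addrC addrK ger0_norm// mulrA.
  rewrite -mulr_suml; have := sum_q; have := q_gt0 k.
  rewrite ler_pdivlMr ?mulr_gt0// in xi1; nra.
have a1 := birkhoff_phi_approx k.+1 n (x + xi).
have a2 := birkhoff_phi_approx k.+1 n x.
have s1 := slow x; have := slow (x + n%:R * alpha).
rewrite (_ : x + _ + xi = x + xi + n%:R * alpha); last by ring.
move=> s2.
have p1 := shift_phase ((q k)%:R * x).
have p2 := shift_phase ((q k)%:R * x + (q k)%:R * xi).
move: a1 a2; rewrite {1 2 3 4}/transfer !big_ord_recr /= -!/(transfer _ _) {1 2 3 4}/wave.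
have -> : (q k)%:R * (x + xi + n%:R * alpha) =
   (q k)%:R * x + (q k)%:R * xi + n%:R * (q k)%:R * alpha by ring.
have -> : (q k)%:R * (x + n%:R * alpha) = (q k)%:R * x + n%:R * (q k)%:R * alpha by ring.
have -> : (q k)%:R * (x + xi) = (q k)%:R * x + (q k)%:R * xi by ring.
move: s1 s2 p1 p2; rewrite !ler_norml.
move=> /andP[? ?] /andP[? ?] /andP[? ?] /andP[? ?] /andP[? ?] /andP[? ?].
by apply/andP; split; lra.
Qed.

(** Over half a period of the k-th wave the linear part of the Birkhoff sum winds
    at least twice, so that some xi there closes up, modulo integers, the increment
    of the sum from n alpha to n alpha + xi; the increment from 0 to xi then misses
    an integer by about ||q_k xi||, which is at least 1/4. *)
Lemma resonant_pair : l != 0 -> exists xi t : R, exists m : int,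
  [/\ 0 <= xi <= 3 / (4 * (q k)%:R), 8^-1 <= N t,
    S twisted n xi - S twisted n 0 = - t &
    S twisted n (n%:R * alpha + xi) - S twisted n (n%:R * alpha) = m%:~R].
Proof.
move=> l0; set y := n%:R * alpha; set Q := (q k)%:R.
have Q0 : 0 < Q := q_gt0 k.
pose a : R := 1 / (4 * Q); pose b : R := 3 / (4 * Q).
have ab : a <= b by rewrite /a /b ler_pM2r ?invr_gt0 ?mulr_gt0//; lra.
have a0 : 0 <= a by rewrite /a divr_ge0 ?mulr_ge0// ltW.
have Qa : Q * a = 4^-1 by rewrite /a; field; exact: lt0r_neq0.
have Qb : Q * b = 3 / 4 by rewrite /b; field; exact: lt0r_neq0.
pose W xi := S twisted n (y + xi) - S twisted n y.
have cW : {within `[a, b], continuous W}.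
  apply: continuous_subspaceT => z; apply: cvgB; last exact: cvg_cst.
  apply: (@continuous_comp _ _ _ (fun xi => y + xi) (S twisted n)).
    by apply: continuousD; [exact: cst_continuous|exact: cvg_id].
  by apply: birkhoff_continuous; case: twisted_calF.
have WE xi : W xi = n%:R * l%:~R * xi + (S phi n (y + xi) - S phi n y).
  by rewrite /W birkhoff_twisted; congr (_ * _ + _); ring.
have gap : 1 <= `|W b - W a|.
  have -> : W b - W a = n%:R * l%:~R * (b - a) + (S phi n (y + a + (b - a)) - S phi n (y + a)).
    by rewrite !WE (_ : y + a + (b - a) = y + b); ring.
  have ba : b - a <= 3 / (4 * Q) by rewrite -/b; lra.
  have := resonant_increment (y + a) (b - a) _ ba; rewrite subr_ge0 => /(_ ab).
  rewrite -/Q; set e := S phi n _ - _; set u := Q * (y + a); set v := Q * (b - a).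
  have := nint_dist_le_half u; have := nint_dist_le_half (u + v).
  have := nint_dist_ge0 u; have := nint_dist_ge0 (u + v).
  move=> u1 u2 u3 u4; rewrite ler_norml => /andP[e1 e2].
  have l1 : 1 <= `|l%:~R : R| by rewrite norm_intr_ge1 ?intr_int// intr_eq0.
  have big : 2 <= `|n%:R * l%:~R * (b - a)|.
    rewrite !normrM (ger0_norm (ler0n _ _)) (@ger0_norm _ (b - a)) ?subr_ge0//.
    have nba : 2 <= n%:R * (b - a).
      by have := n_large; rewrite -/Q; have : Q * (b - a) = 2^-1; [lra|nra].
    by rewrite mulrAC; nra.
  have := lerB_normD (n%:R * l%:~R * (b - a)) e.
  have : `|e| <= 1 by rewrite ler_norml; apply/andP; split; lra.
  lra.
have [m hm] : exists m : int, Num.min (W a) (W b) <= m%:~R <= Num.max (W a) (W b).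
  exists (Num.floor (Num.max (W a) (W b))).
  have /andP[-> h] := floor_itv (Num.max (W a) (W b)); rewrite andbT.
  move: h gap; rewrite intrD.
  by case: (leP (W a) (W b)) => ? ?; [rewrite ger0_norm|rewrite ltr0_norm]; lra.
have [xi] := IVT ab cW hm.
rewrite in_itv /= => /andP[axi xib] Wxi.
exists xi, (- (S twisted n xi - S twisted n 0)), m; split => //; last by rewrite opprK.
  by apply/andP; split => //; lra.
have xi0 : 0 <= xi by lra.
have r1 := resonant_increment 0 xi xi0 xib.
have r2 := resonant_increment y xi xi0 xib.
move: r1 r2; rewrite -/Q mulr0 !add0r nint_dist0.
have := shift_phase 0; have := shift_phase (Q * xi).
rewrite add0r nint_dist0 -/Q.
have -> : Q * xi + n%:R * Q * alpha = Q * y + Q * xi by rewrite /y; ring.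
have -> : n%:R * Q * alpha = Q * y by rewrite /y; ring.
have v1 : 4^-1 <= Q * xi <= 3 / 4 by apply/andP; split; nra.
have v2 : 4^-1 <= N (Q * xi).
  have := nint_dist_half (Q * xi - 2^-1); rewrite subrK => ->.
  have /andP[? ?] := v1.
  have : `|Q * xi - 2^-1| <= 4^-1 by rewrite ler_norml; apply/andP; split; lra.
  by have := nint_dist_le_norm (Q * xi - 2^-1); lra.
have v3 := nint_dist_le_half (Q * xi).
have e1 : S twisted n xi - S twisted n 0 = n%:R * l%:~R * xi + (S phi n xi - S phi n 0).
  by rewrite birkhoff_twisted subr0.
have := WE xi; rewrite Wxi => e2.
rewrite nint_distN e1 !ler_norml => /andP[? ?] /andP[? ?] /andP[? ?] /andP[? ?].
set t := _ + _.
rewrite -(nint_distD_int _ (- m)) -nint_distN rmorphN /=; apply: nint_dist_ge.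
by rewrite /t; apply/andP; split; lra.
Qed.

End ResonantTime.

End ResonantCocycle.

(** * Minimality of skew products *)

(** Compactness of the m-dimensional torus, read on representatives. *)
Lemma cluster_mod1 (R : realType) (m : nat) (z : nat -> nat -> R) :
  exists p : nat -> R, forall (e : R) (K : nat), 0 < e ->
    exists2 k, (K <= k)%N & forall i, (i < m)%N -> nint_dist (z k i - p i) < e.
Proof.
pose fr (x : R) := x - (Num.floor x)%:~R.
have fr01 x : fr x \in `[0, 1].
  have /andP[h1 h2] := floor_itv x; move: h2; rewrite /fr intrD in_itv /= => h2.
  by apply/andP; split; lra.
pose v k : 'rV[R]_m := \row_(i < m) fr (z k i).
have cK : compact [set v : 'rV[R]_m | forall i, v ord0 i \in `[0, 1]].
  exact: (@rV_compact R m (fun=> [set x | x \in `[0, 1]]) (fun=> @segment_compact R 0 1)).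
have [|p [_ clp]] := cK (v @ \oo) _.
  by exists 0%N => // k _ i; rewrite mxE.
exists (fun i => if insub i is Some j then p ord0 j else 0) => e K e0.
have FA : (v @ \oo) [set v k | k in [set k | (K <= k)%N]].
  by exists K => // k /= Kk; exists k.
have [_ [[k Kk <-] hk]] := clp _ (ball p e) FA (nbhsx_ballx p e e0).
exists k => // i im; rewrite insubT.
have [_ hk2] := (hk : @mx_ball _ _ _ _ p e (v k)).
have := hk2 ord0 (Ordinal im); rewrite mxE /ball /= => h.
apply: le_lt_trans (nint_dist_le _ (- Num.floor (z k i))) _.
by move: h; rewrite distrC /fr rmorphN /=; congr (`|_| < _); ring.
Qed.

Lemma rotation_dense (R : realType) (alpha z e : R) : irrational alpha -> 0 < e ->
  exists n : nat, nint_dist (n%:R * alpha - z) < e.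
Proof.
move=> irr e0; have [q [_ q0 qe _]] := good_denominator alpha 0 e irr e0.
have := @multiples_dense _ (q%:R * alpha) e z.
rewrite qe nint_dist_irrational// => /(_ isT)[n hn].
by exists (n * q)%N; rewrite natrM -mulrA.
Qed.

Section OrbitClosure.
Context {R : realType} {alpha : R} {l : int} {f : R -> R}.
Hypothesis irr : irrational alpha.
Hypothesis hf : calF l f.

Notation S := (birkhoff alpha f).
Notation N := nint_dist.
Implicit Types (x y t e : R) (n : nat).

Lemma birkhoff_int n x (m : int) : exists k : int, S n (x + m%:~R) = S n x + k%:~R.
Proof.
elim: n => [|n [k IH]]; first by exists 0; rewrite !birkhoff0 addr0.
have [j hj] := calF_int hf (x + n%:R * alpha) m; exists (k + j).
rewrite !birkhoffS IH intrD.
by rewrite (_ : x + m%:~R + _ = x + n%:R * alpha + m%:~R) ?hj; ring.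
Qed.

Lemma birkhoff_add1 n x : S n (x + 1) - S n x = n%:R * l%:~R.
Proof.
elim: n => [|n IH]; first by rewrite !birkhoff0 subrr mul0r.
rewrite !birkhoffS opprD addrACA IH.
rewrite (_ : x + 1 + _ = x + n%:R * alpha + 1); last by ring.
by rewrite hf.2 -natr1; ring.
Qed.

Lemma birkhoff_mod1_continuous n x e : 0 < e ->
  exists2 d, 0 < d & forall x', N (x' - x) < d -> N (S n x' - S n x) < e.
Proof.
move=> e0; have /cvgrPdist_lt/(_ e e0) := @birkhoff_continuous R alpha f n hf.1 x.
move=> /nbhs_ballP[d /= d0 hd]; exists d => // x' hx.
have [m hm] := nint_distP (x' - x).
have [k hk] := birkhoff_int n x' m.
rewrite -(nint_distD_int _ k); apply: le_lt_trans (nint_dist_le_norm _) _.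
rewrite addrAC -hk distrC.
by apply: hd; rewrite /ball /= distrC addrAC -hm.
Qed.

(** Orbit closures of the skew product are read on real representatives, on which
    the Birkhoff sums are continuous real functions. *)
Definition orbit_closure x0 y0 x y : Prop := forall e, 0 < e -> exists n,
  N (x0 + n%:R * alpha - x) < e /\ N (y0 + S n x0 - y) < e.

Notation oc := orbit_closure.

Lemma oc_refl x y : oc x y x y.
Proof.
move=> e e0; exists 0%N.
by rewrite birkhoff0 mul0r !addr0 !subrr nint_dist0.
Qed.

Lemma oc_closed x0 y0 x y :
  (forall e, 0 < e -> exists x' y', [/\ oc x0 y0 x' y', N (x' - x) < e & N (y' - y) < e]) ->
  oc x0 y0 x y.
Proof.
move=> h e e0; have e2 : 0 < e / 2 by rewrite divr_gt0.
have [x' [y' [H hx hy]]] := h _ e2; have [n [hx' hy']] := H _ e2.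
exists n; split.
  have := nint_distD (x0 + n%:R * alpha - x') (x' - x); rewrite addrA subrK; lra.
have := nint_distD (y0 + S n x0 - y') (y' - y); rewrite addrA subrK; lra.
Qed.

Lemma oc_trans x0 y0 x1 y1 x y : oc x0 y0 x1 y1 -> oc x1 y1 x y -> oc x0 y0 x y.
Proof.
move=> h1 h2 e e0; have e2 : 0 < e / 2 by rewrite divr_gt0.
have [n [hx hy]] := h2 _ e2.
have e4 : 0 < e / 4 by rewrite divr_gt0.
have [d d0 hd] := birkhoff_mod1_continuous n x1 _ e4.
have md : 0 < Num.min d (e / 4) by rewrite lt_min d0.
have [m [hx' hy']] := h1 _ md; rewrite !lt_min in hx' hy'.
have /andP[hx1 hx2] := hx'; have /andP[hy1 hy2] := hy'.
exists (m + n)%N; rewrite birkhoffD natrD; split.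
  have := nint_distD (x0 + m%:R * alpha - x1) (x1 + n%:R * alpha - x).
  rewrite (_ : _ + _ = x0 + (m%:R + n%:R) * alpha - x); [lra|ring].
have := hd _ hx1.
have := nint_distD (y0 + S m x0 - y1) (S n (x0 + m%:R * alpha) - S n x1).
have := nint_distD (y0 + S m x0 - y1 + (S n (x0 + m%:R * alpha) - S n x1)) (y1 + S n x1 - y).
rewrite (_ : _ + _ + (_ + _) = y0 + (S m x0 + S n (x0 + m%:R * alpha)) - y); [lra|ring].
Qed.

Lemma oc_iter x0 y0 x y n : oc x0 y0 x y -> oc x0 y0 (x + n%:R * alpha) (y + S n x).
Proof. by move/oc_trans; apply => e e0; exists n; rewrite !subrr nint_dist0. Qed.

Lemma oc_vert x0 y0 x y t : oc x0 y0 x y -> oc x0 (y0 + t) x (y + t).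
Proof.
move=> h e e0; have [n [hx hy]] := h e e0; exists n; split => //.
by rewrite (_ : _ - _ = y0 + S n x0 - y)//; ring.
Qed.

(** The base rotation is minimal, and the fibres are compact. *)
Lemma oc_fibre x0 y0 x : exists y, oc x0 y0 x y.
Proof.
have /choice[n hn] : forall k, exists n, N (x0 + n%:R * alpha - x) < k.+1%:R^-1.
  move=> k; have k0 : 0 < k.+1%:R^-1 :> R by rewrite invr_gt0.
  have [n hn] := rotation_dense _ alpha (x - x0) _ irr k0.
  by exists n; rewrite (_ : _ - x = n%:R * alpha - (x - x0))//; ring.
have [p hp] := cluster_mod1 _ 1 (fun k _ => y0 + S (n k) x0).
exists (p 0%N) => e e0; have [k Kk hk] := hp e (Num.truncn e^-1) e0.
exists (n k); split; last exact: hk.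
apply: lt_le_trans (hn k) _; rewrite invf_ple ?posrE//.
apply: ltW; apply: lt_le_trans (truncnS_gt _) _; by rewrite ler_nat.
Qed.

Section Stabilizer.
Variables x0 y0 : R.

(** The vertical rotations that keep the orbit closure of (x0, y0) invariant. *)
Definition stab t : Prop := oc x0 y0 x0 (y0 + t).

Lemma stabD s t : stab s -> stab t -> stab (s + t).
Proof.
by move=> hs ht; rewrite /stab addrA; exact: oc_trans ht (oc_vert _ _ _ _ t hs).
Qed.

Lemma stabMn t n : stab t -> stab (n%:R * t).
Proof.
move=> ht; elim: n => [|n IH]; first by rewrite mul0r /stab addr0; exact: oc_refl.
by rewrite -natr1 mulrDl mul1r; exact: stabD.
Qed.

Lemma stab_closed t : (forall e, 0 < e -> exists2 s, stab s & N (s - t) < e) -> stab t.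
Proof.
move=> h; apply: oc_closed => e e0; have [s hs hst] := h e e0.
exists x0, (y0 + s); split => //; first by rewrite subrr nint_dist0.
by rewrite (_ : _ - _ = s - t)//; ring.
Qed.

(** A closed subsemigroup of the circle is a group: t returns close to 0 at some
    time q >= 1, and then (q - 1) t is close to - t. *)
Lemma stabN t : stab t -> stab (- t).
Proof.
move=> ht; apply: stab_closed => e e0.
have [q [q0 _ hq]] := @dirichlet _ t (Num.truncn e^-1).+1 isT.
exists (q.-1%:R * t); first exact: stabMn.
rewrite opprK -[X in _ + X]mul1r -mulrDl natr1 prednK//.
rewrite -(ltr_pM2r (_ : 0 < (Num.truncn e^-1).+1%:R))//; apply: lt_trans hq _.
by rewrite -ltr_pdivrMl// mulr1 truncnS_gt.
Qed.

(** Orbit closures are minimal. A point of the orbit closure of (x0, y0) comes back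
    over x0 at a height z, where z - y0 is in [stab]; as [stab] is a group, the
    vertical rotation by y0 - z leads from there to (x0, y0). *)
Lemma oc_back x y : oc x0 y0 x y -> oc x y x0 y0.
Proof.
move=> h; have [z hz] := oc_fibre x y x0.
have ht : stab (z - y0) by rewrite /stab addrC subrK; exact: oc_trans h hz.
apply: oc_trans hz _.
have := oc_vert _ _ _ _ (z - y0) (stabN _ ht).
by rewrite subrK (_ : y0 + (z - y0) = z)//; ring.
Qed.

Lemma stab_diff x y s : oc x0 y0 x y -> oc x0 y0 x (y + s) -> stab s.
Proof.
move=> h hs; apply: oc_trans hs _; apply: oc_vert; exact: oc_back.
Qed.

Lemma oc_stab x y s : oc x0 y0 x y -> stab s -> oc x0 y0 x (y + s).
Proof. by move=> h hs; apply: oc_trans hs _; exact: oc_vert. Qed.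

Lemma oc_all : (forall t, stab t) -> forall x y, oc x0 y0 x y.
Proof.
move=> h x y; have [z hz] := oc_fibre x0 y0 x.
by have := oc_stab _ _ _ hz (h (y - z)); rewrite addrC subrK.
Qed.

(** A nonzero element close to 0 would have dense multiples. *)
Lemma stab_gap : ~ (forall t, stab t) ->
  exists2 eta, 0 < eta <= 2^-1 & forall t, stab t -> N t = 0 \/ eta <= N t.
Proof.
move=> /existsNP[t0 ht0].
have [e e0 he] : exists2 e, 0 < e & forall s, stab s -> e <= N (s - t0).
  apply: contrapT => h; apply: ht0; apply: stab_closed => e e0.
  apply: contrapT => h'; apply: h; exists e => // s hs.
  by rewrite leNgt; apply/negP => lt; apply: h'; exists s.
exists (Num.min e 2^-1); first by rewrite lt_min e0 invr_gt0 ltr0n ge_min lexx orbT.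
move=> t ht; have [h|h] := leP (Num.min e 2^-1) (N t); first by right.
left; have he' : N t < e by apply: lt_le_trans h _; rewrite ge_min lexx.
apply/eqP; rewrite eq_le nint_dist_ge0 andbT leNgt; apply/negP => t0'.
have := @multiples_dense _ t e t0; rewrite t0' he' => /(_ isT)[n hn].
by have := he _ (stabMn _ n ht); rewrite leNgt hn.
Qed.

(** The fibres of a minimal set depend continuously on the base point, uniformly:
    they are cosets of [stab], so a limit of points of nearby fibres can be moved
    vertically onto any given point of the limit fibre. *)
Lemma oc_fibre_continuous e : 0 < e ->
  exists2 d, 0 < d & forall x y x', oc x0 y0 x y -> N (x' - x) < d ->
    exists2 y', oc x0 y0 x' y' & N (y' - y) < e.
Proof.
move=> e0; apply: contrapT => H.
have /choice[z hz] : forall k : nat, exists z : R * R * R,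
    [/\ oc x0 y0 z.1.1 z.1.2, N (z.2 - z.1.1) < k.+1%:R^-1 &
        forall y', oc x0 y0 z.2 y' -> e <= N (y' - z.1.2)].
  move=> k; apply: contrapT => h; apply: H; exists k.+1%:R^-1; first by rewrite invr_gt0.
  move=> x y x' hxy hx; apply: contrapT => h'; apply: h.
  exists (x, y, x'); split => //= y' hy'.
  by rewrite leNgt; apply/negP => lt; apply: h'; exists y'.
have /choice[w hw] : forall k, exists w, oc x0 y0 (z k).2 w by move=> k; exact: oc_fibre.
have [p hp] := cluster_mod1 _ 4 (fun k => nth 0 [:: (z k).1.1; (z k).1.2; (z k).2; w k]).
have cl e' : 0 < e' -> exists k, [/\ N ((z k).1.1 - p 0%N) < e', N ((z k).1.2 - p 1%N) < e',
    N ((z k).2 - p 2%N) < e', N (w k - p 3%N) < e' & N ((z k).2 - (z k).1.1) < e'].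
  move=> e0'; have [k Kk hk] := hp e' (Num.truncn e'^-1) e0'.
  exists k; split; [exact: (hk 0%N)|exact: (hk 1%N)|exact: (hk 2%N)|exact: (hk 3%N)|].
  have [_ h _] := hz k; apply: lt_le_trans h _; rewrite invf_ple ?posrE//.
  by apply: ltW; apply: lt_le_trans (truncnS_gt _) _; rewrite ler_nat.
have oc1 : oc x0 y0 (p 0%N) (p 1%N).
  apply: oc_closed => e' e0'; have [k [h1 h2 _ _ _]] := cl e' e0'.
  by exists (z k).1.1, (z k).1.2; have [h _ _] := hz k.
have oc2 : oc x0 y0 (p 0%N) (p 3%N).
  apply: oc_closed => e' e0'; have e2 : 0 < e' / 2 by rewrite divr_gt0.
  have [k [h1 _ _ h4 h5]] := cl _ e2.
  exists (z k).2, (w k); split; [exact: hw| |lra].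
  have := nint_distD ((z k).2 - (z k).1.1) ((z k).1.1 - p 0%N); rewrite addrA subrK; lra.
have hs : stab (p 1%N - p 3%N).
  by apply: (stab_diff _ _ _ oc2); rewrite addrC subrK.
have e2 : 0 < e / 2 by rewrite divr_gt0.
have [k [_ h2 _ h4 _]] := cl _ e2.
have [_ _ h] := hz k; have := h _ (oc_stab _ _ _ (hw k) hs).
have := nint_distD (w k - p 3%N) (- ((z k).1.2 - p 1%N)); rewrite nint_distN.
rewrite (_ : _ + - _ = w k + (p 1%N - p 3%N) - (z k).1.2); [lra|ring].
Qed.

(** Furstenberg: otherwise the fibres of the orbit closure are cosets of a discrete
    group, so that over short intervals the Birkhoff sums, being close to that
    group and continuous, vary little, uniformly in n. But over a full turn they
    grow by n l. *)
Lemma stab_full : l != 0 -> forall t, stab t.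
Proof.
move=> l0; apply: contrapT => /stab_gap[eta /andP[eta0 eta1] heta].
have [d d0 hd] := oc_fibre_continuous (eta / 8) (divr_gt0 eta0 (ltr0Sn _ 7)).
have near_stab n x x' : N (x' - x) < d ->
    exists2 h, stab h & N (S n x' - S n x - h) < eta / 4.
  move=> hx; have [y hy] := oc_fibre x0 y0 x.
  have [y' hy' yy'] := hd _ _ _ hy hx.
  have hx' : N (x' + n%:R * alpha - (x + n%:R * alpha)) < d.
    by rewrite (_ : _ - _ = x' - x)//; ring.
  have [y'' hy'' yy''] := hd _ _ _ (oc_iter _ _ _ _ n hy) hx'.
  exists (y' + S n x' - y'').
    by apply: (stab_diff _ _ _ hy''); rewrite [y'' + _]addrC subrK; exact: oc_iter.
  have := nint_distD (y'' - (y + S n x)) (- (y' - y)); rewrite nint_distN.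
  rewrite (_ : _ + - _ = S n x' - S n x - (y' + S n x' - y'')); [lra|ring].
pose K := (Num.truncn d^-1).+1.
have K0 : 0 < K%:R :> R by rewrite ltr0n.
have Kd : K%:R^-1 < d by rewrite invf_plt ?posrE// truncnS_gt.
have small n x : `|S n (x + K%:R^-1) - S n x| <= 1.
  pose W z := S n (x + z) - S n x.
  have W0 : W 0 = 0 by rewrite /W addr0 subrr.
  have cW : {within `[0, K%:R^-1], continuous W}.
    apply: continuous_subspaceT => z; apply: cvgB; last exact: cvg_cst.
    apply: (@continuous_comp _ _ _ (fun z => x + z) (S n)).
      by apply: cvgD; [exact: cvg_cst|exact: cvg_id].
    by apply: birkhoff_continuous; case: hf.
  have cA : {within `[0, K%:R^-1], continuous (fun z => `|W z|)}.
    by move=> z; apply: cvg_norm; exact: cW.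
  rewrite leNgt; apply/negP => big.
  have K1 : 0 <= K%:R^-1 :> R by rewrite invr_ge0 ltW.
  have [|z] := @IVT R _ _ _ (eta / 2) K1 cA.
    by rewrite W0 normr0 ge_min le_max; apply/andP; split; apply/orP; [left|right]; lra.
  rewrite in_itv /= => /andP[z0 zK] Wz.
  have hz : N (x + z - x) < d.
    rewrite addrC addKr; apply: le_lt_trans (nint_dist_le_norm _) _.
    by rewrite ger0_norm//; lra.
  have [h hs hWh] := near_stab n _ _ hz; rewrite -/(W z) in hWh.
  have NW : N (W z) = eta / 2 by rewrite nint_dist_small Wz//; lra.
  (* h is neither 0 nor at distance eta from 0 *)
  have := nint_distD (W z - h) h; rewrite subrK NW.
  have := nint_distD (W z) (- (W z - h)); rewrite nint_distN NW opprB addrC subrK.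
  by case: (heta h hs); lra.
have grow n j : `|S n (j%:R / K%:R) - S n 0| <= j%:R.
  elim: j => [|j IH]; first by rewrite mul0r subrr normr0.
  have := small n (j%:R / K%:R).
  rewrite (_ : j%:R / _ + _ = j.+1%:R / K%:R); last by rewrite -natr1 mulrDl mul1r.
  rewrite -[X in _ -> _ <= X]natr1.
  have := ler_normD (S n (j.+1%:R / K%:R) - S n (j%:R / K%:R))
    (S n (j%:R / K%:R) - S n 0).
  by rewrite addrA subrK; lra.
have := grow K.+1 K; rewrite divff ?gt_eqF//.
have := birkhoff_add1 K.+1 0; rewrite add0r => ->.
have l1 : 1 <= `|l%:~R : R| by rewrite norm_intr_ge1 ?intr_int// intr_eq0.
by rewrite normrM ger0_norm ?ler0n// -natr1; nra.
Qed.

End Stabilizer.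

End OrbitClosure.

(** * Skew products on the torus *)

Section Torus.
Context {R : realType}.
Notation C := (@to_circle R).
Notation N := nint_dist.
Notation X := (circle R * circle R)%type.

Lemma mdist_circle (x y : R) : mdist (C x) (C y) = N (x - y).
Proof. exact: circle_distE. Qed.

Lemma mdist_torus (u w : X) : mdist u w = Num.max (mdist u.1 w.1) (mdist u.2 w.2).
Proof. by []. Qed.

Lemma torus_repr (u : X) : u = (C (repr u.1), C (repr u.2)).
Proof. by case: u => a b; rewrite !repr_circleK. Qed.

Lemma mdist_circleD (a b c : circle R) : mdist (a + c) (b + c) = mdist a b.
Proof.
rewrite -(repr_circleK a) -(repr_circleK b) -(repr_circleK c) -!to_circleD !mdist_circle.
by congr N; ring.
Qed.

Lemma nbhs_torus (x y : R) (A : set X) : nbhs (C x, C y) A ->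
  exists2 e, 0 < e & forall x' y', N (x - x') < e -> N (y - y') < e -> A (C x', C y').
Proof.
move=> /nbhs_ballP[e /= e0 h]; exists e => // x' y' hx hy; apply: h.
by rewrite ballEmdist /= mdist_torus gt_max !mdist_circle hx hy.
Qed.

Context (alpha : R) {l : int} {f : R -> R} (hf : calF l f).
Notation S := (birkhoff alpha f).
Notation T := (skew_homeo alpha hf).

Lemma iter_skew n x y : iter n T (C x, C y) = (C (x + n%:R * alpha), C (y + S n x)).
Proof.
elim: n => [|n IH]; first by rewrite mul0r birkhoff0 !addr0.
rewrite iterS IH /= /Defs.skew /= (circle_mapE hf) -!to_circleD birkhoffS -natr1.
by congr pair; [rewrite mulrDl mul1r addrA|rewrite addrC addrA].
Qed.

Lemma skew_minimal : irrational alpha -> l != 0 -> minimal T.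
Proof.
move=> irr l0 u O [w Ow] oO.
rewrite (torus_repr w) in Ow; rewrite (torus_repr u).
set x0 := repr u.1; set y0 := repr u.2; set x := repr w.1 in Ow; set y := repr w.2 in Ow.
have [e e0 he] := nbhs_torus _ _ _ (open_nbhs_nbhs (conj oO Ow)).
have h := oc_all irr hf x0 y0 (stab_full irr hf x0 y0 l0) x y.
have [n [hx hy]] := h e e0.
exists (iter n T (C x0, C y0)); split; last by exists n%:Z.
by rewrite iter_skew; apply: he; rewrite -nint_distN opprB.
Qed.

(** Distances between first coordinates are constant along the orbits, and so are
    distances between second coordinates of points of a common fibre. *)
Lemma skew_distal : distal T.
Proof.
move=> u w uw.
pose c := if u.1 == w.1 then mdist u.2 w.2 else mdist u.1 w.1.
have c0 : 0 < c.
  rewrite /c; case: eqP => [e|/eqP ne]; last by rewrite mdist_gt0.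
  rewrite mdist_gt0; apply: contra uw => /eqP e2.
  by rewrite (surjective_pairing u) (surjective_pairing w) e e2.
apply: lt_le_trans c0 _; apply: lb_le_inf.
  by exists (mdist (iterz T 0 u) (iterz T 0 w)), 0.
have inv (F : X -> X) k :
    (forall a b : X, mdist (F a).1 (F b).1 = mdist a.1 b.1) ->
    (forall a b : X, a.1 = b.1 -> mdist (F a).2 (F b).2 = mdist a.2 b.2) ->
    c <= mdist (iter k F u) (iter k F w).
  move=> h1 h2.
  have e1 : mdist (iter k F u).1 (iter k F w).1 = mdist u.1 w.1.
    by elim: k => //= k IH; rewrite h1.
  rewrite mdist_torus le_max /c; case: eqP => [e|_]; last by rewrite e1 lexx.
  apply/orP; right.
  suff [_ ->] : (iter k F u).1 = (iter k F w).1 /\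
      mdist (iter k F u).2 (iter k F w).2 = mdist u.2 w.2 by [].
  elim: k {e1} => //= k [IH1 IH2]; rewrite h2// IH2; split=> //.
  by apply: mdist_positivity; rewrite h1 IH1 mdistxx.
move=> _ [[k|k] _ <-] /=.
  apply: (inv T) => [a b|a b ab] /=; first by rewrite mdist_circleD.
  by rewrite ab ![_ + _.2]addrC mdist_circleD.
rewrite -!iterS; apply: (inv (homeo_inv T)) => [a b|a b ab] /=.
  by rewrite mdist_circleD.
by rewrite ab mdist_circleD.
Qed.

End Torus.

Section NotOrderTwo.
Context {R : realType} {alpha : R} {q : nat -> nat} {l : int}.
Hypothesis hq : resonant_sequence alpha q.
Notation C := (@to_circle R).
Notation N := nint_dist.
Notation f := (@twisted R alpha q l).
Notation S := (birkhoff alpha f).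
Notation T := (skew_homeo alpha (twisted_calF hq l)).

(** The points (0, 0) and (xi, t) given by [resonant_pair] have orbits at
    distance at most xi at the times n and 2 n, and xi tends to 0 with k, while t
    stays away from 0. *)
Lemma twisted_regionally_proximal2 : l != 0 ->
  exists2 t : R, 0 < N t & regionally_proximal2 T (C 0, C 0) (C 0, C t).
Proof.
move=> l0; pose n := @resonant_time R alpha q.
have ex k : exists xt : R * R, [/\ 0 <= xt.1 <= 3 / (4 * (q k)%:R), 8^-1 <= N xt.2,
    S (n k) xt.1 - S (n k) 0 = - xt.2 &
    exists m : int,
      S (n k) ((n k)%:R * alpha + xt.1) - S (n k) ((n k)%:R * alpha) = m%:~R].
  have [xi [t [m [h1 h2 h3 h4]]]] := resonant_pair hq l k l0.
  by exists (xi, t); split => //; exists m.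
have [xt hxt] := choice ex.
have [p hp] := cluster_mod1 _ 5 (fun k => nth 0 [:: (xt k).2; (n k)%:R * alpha;
  S (n k) 0; (n k + n k)%:R * alpha; S (n k + n k)%N 0]).
exists (p 0%N).
  have p16 : 0 < 16^-1 :> R by rewrite invr_gt0.
  have [k _ hk] := hp 16^-1 0%N p16.
  have [_ h _ _] := hxt k; have := hk 0%N isT => /= h'.
  have := nint_distD ((xt k).2) (- ((xt k).2 - p 0%N)); rewrite nint_distN opprB addrC subrK.
  have := nint_distD ((xt k).2 - p 0%N) (p 0%N); rewrite subrK; lra.
exists (C (p 1%N), C (p 2%N)), (C (p 1%N), C (p 2%N)), (C (p 3%N), C (p 4%N)).
move=> A B C1 C2 C3 /nbhs_torus[e1 e10 hA] /nbhs_torus[e2 e20 hB]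
  /nbhs_torus[e3 e30 h1] /nbhs_torus[e4 e40 h2] /nbhs_torus[e5 e50 h3].
pose e := Num.min e2 (Num.min e3 (Num.min e4 e5)).
have e0 : 0 < e by rewrite !lt_min e20 e30 e40 e50.
have [le2 le3 le4 le5] : [/\ e <= e2, e <= e3, e <= e4 & e <= e5].
  have : e <= Num.min e2 (Num.min e3 (Num.min e4 e5)) by [].
  by rewrite !le_min => /and4P[].
have ee : 0 < e / 2 by rewrite divr_gt0.
have [k Kk hk] := hp (e / 2) (Num.truncn (e / 2)^-1) ee.
have [/andP[x0 x1] _ H1 [m H2]] := hxt k.
have xe : (xt k).1 < e / 2.
  apply: le_lt_trans x1 _; apply: (@le_lt_trans _ _ (q k)%:R^-1).
    have q0 : 0 < (q k)%:R^-1 :> R by rewrite invr_gt0 ltr0n; have [] := hq k.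
    by rewrite invfM; lra.
  rewrite invf_plt ?posrE//; last by rewrite ltr0n; have [] := hq k.
  apply: lt_le_trans (truncnS_gt _) _.
  by apply: le_trans (resonant_ge hq k); rewrite ler_nat.
have Nx : N (xt k).1 < e / 2 by apply: le_lt_trans (nint_dist_le_norm _) _; rewrite ger0_norm.
exists (C 0, C 0), (C (xt k).1, C (xt k).2), (n k), (n k); split.
- by apply: hA; rewrite subrr nint_dist0.
- apply: hB; first by rewrite sub0r nint_distN; lra.
  by rewrite -nint_distN opprB; have /= := hk 0%N isT; lra.
(* at the chosen times both orbits are within e of the limit points *)
have close x y a b e' (D : set (circle R * circle R)) :
    (forall x' y', N (a - x') < e' -> N (b - y') < e' -> D (C x', C y')) ->
    e <= e' -> N (x - a) < e / 2 -> N (y - b) < e / 2 ->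
    forall x' y' (j : int), x' = x \/ x' = x + (xt k).1 -> y' = y + j%:~R -> D (C x', C y').
  move=> hD ee' hx hy x' y' j xE ->; apply: hD; last first.
    by rewrite -nint_distN opprB addrAC nint_distD_int; lra.
  rewrite -nint_distN opprB; case: xE => ->; first lra.
  by have := nint_distD (x - a) (xt k).1; rewrite addrAC; lra.
have k1 := hk 1%N isT; have k2 := hk 2%N isT; have k3 := hk 3%N isT; have k4 := hk 4%N isT.
rewrite /= in k1 k2 k3 k4.
have yE1 : (xt k).2 + S (n k) (xt k).1 = S (n k) 0 + 0%:~R by move: H1; rewrite addr0; lra.
have yE2 : (xt k).2 + S (n k + n k)%N (xt k).1 = S (n k + n k)%N 0 + m%:~R.
  by move: H1 H2; rewrite !birkhoffD add0r [(xt k).1 + _]addrC; lra.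
move=> z [->|->]; rewrite !iter_skew ?add0r; split.
- by apply: (close _ _ _ _ _ _ h1 le3 k1 k2 _ _ 0); [left|rewrite addr0].
- by apply: (close _ _ _ _ _ _ h2 le4 k1 k2 _ _ 0); [left|rewrite addr0].
- by apply: (close _ _ _ _ _ _ h3 le5 k3 k4 _ _ 0); [left|rewrite addr0].
- by apply: (close _ _ _ _ _ _ h1 le3 k1 k2 _ _ 0); [right; rewrite addrC|].
- by apply: (close _ _ _ _ _ _ h2 le4 k1 k2 _ _ 0); [right; rewrite addrC|].
- by apply: (close _ _ _ _ _ _ h3 le5 k3 k4 _ _ m); [right; rewrite addrC|].
Qed.

Lemma twisted_not_order2 : l != 0 -> ~ system_of_order R 2 T.
Proof.
move=> l0 o2; have [t t0] := twisted_regionally_proximal2 l0.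
move=> /(order2_regionally_proximal2 _ _ _ _ _ o2)[].
move=> /to_circleE[m] e; move: t0.
by rewrite (_ : t = (- m)%:~R) ?nint_dist_int ?ltxx// rmorphN /=; lra.
Qed.

End NotOrderTwo.

(** * Complexity *)

Section Complexity.
Context {R : realType} {alpha : R} {l : int} {f : R -> R} (hf : calF l f).
Notation C := (@to_circle R).
Notation N := nint_dist.
Notation S := (birkhoff alpha f).
Notation T := (skew_homeo alpha hf).

(* the linear part of the Birkhoff sums dominates at the scales where
   n |x - y| is large *)
Hypothesis twist : forall n x y s, 0 < s -> n%:R * `|x - y| <= s ^+ 2 ->
  `|S n x - S n y - n%:R * l%:~R * (x - y)| <= 2 * s.

Lemma bowen_skew_le n eps x y x' y' : 0 <= eps ->
  bowen_dist T n (C x, C y) (C x', C y') <= eps <->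
  forall i, (i < n)%N -> N (x - x') <= eps /\ N (y + S i x - (y' + S i x')) <= eps.
Proof.
move=> e0; split => [/bigmax_leP[_ h] i ilt|h].
  have := h (Ordinal ilt) isT; rewrite /= !(iter_skew _ hf) mdist_torus ge_max !mdist_circle.
  by rewrite (_ : x + _ - _ = x - x') => [/andP[]|]; last ring.
apply/bigmax_leP; split => // i _; have [h1 h2] := h i (ltn_ord i).
rewrite !(iter_skew _ hf) mdist_torus ge_max !mdist_circle.
by rewrite (_ : x + _ - _ = x - x') ?h1 ?h2//; ring.
Qed.

(** A grid with a n columns and b rows is (n, eps)-spanning: for k < n the Birkhoff
    sums vary by at most |l| / a + 2 / sqrt a over the width 1 / (a n) of a
    column. *)
Lemma span_card_skew_le eps : 0 < eps ->
  exists2 c : R, 0 < c & forall n, (0 < n)%N -> (span_card T n eps <= (c * n%:R)%:E)%E.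
Proof.
move=> e0.
pose L : R := `|l%:~R|.
have L0 : 0 <= L by rewrite normr_ge0.
pose s := eps / 8.
have s0 : 0 < s by rewrite divr_gt0.
pose a := (Num.truncn (s ^- 2 + 4 * L / eps + eps^-1)).+1.
pose b := (Num.truncn (4 / eps)).+1.
have a0 : 0 < a%:R :> R by rewrite ltr0n.
have b0 : 0 < b%:R :> R by rewrite ltr0n.
have ha : s ^- 2 + 4 * L / eps + eps^-1 < a%:R by rewrite truncnS_gt.
have hb : b%:R^-1 <= eps / 4.
  by rewrite invf_ple ?posrE ?divr_gt0// invf_div ltW// truncnS_gt.
have p1 : 0 < s ^- 2 by rewrite invr_gt0 exprn_gt0.
have p2 : 0 <= 4 * L / eps by rewrite divr_ge0 ?mulr_ge0// ltW.
have p3 : 0 < eps^-1 by rewrite invr_gt0.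
have a1 : a%:R^-1 <= s ^+ 2 by rewrite invf_ple ?posrE ?exprn_gt0//; lra.
have a2 : L * a%:R^-1 <= eps / 4.
  rewrite ler_pdivrMr// -ler_pdivrMl ?divr_gt0//.
  by rewrite invf_div mulrAC; lra.
have a3 : a%:R^-1 <= eps by rewrite invf_ple ?posrE//; lra.
exists (a%:R * b%:R); first by rewrite mulr_gt0.
move=> n n0; have n0R : 0 < n%:R :> R by rewrite ltr0n.
pose pt (p : nat * nat) := (C (p.1%:R / (a * n)%:R), C (p.2%:R / b%:R)).
pose F : {fset circle R * circle R} :=
  [fset x in [seq pt p | p <- [seq (i, j) | i <- iota 0 (a * n), j <- iota 0 b]]]%fset.
apply: ge_ereal_inf; exists (#|` F|%:R)%:E; last first.
  rewrite lee_fin card_fseq -!natrM ler_nat.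
  by rewrite (leq_trans (size_undup _))// size_map size_allpairs !size_iota mulnAC.
exists F => // u.
have grid (m : nat) (x : R) : (0 < m)%N ->
    exists2 i, (i < m)%N & exists x', C x' = C x /\ `|x' - i%:R / m%:R| <= m%:R^-1.
  move=> m0; have m0R : 0 < m%:R :> R by rewrite ltr0n.
  have /andP[f1 f2] := floor_itv x; rewrite intrD in f2.
  set x' := x - (Num.floor x)%:~R.
  have x0 : 0 <= m%:R * x' by rewrite mulr_ge0 ?(ltW m0R)// /x'; lra.
  have /andP[i1 i2] := truncn_itv x0; set i := Num.truncn _ in i1 i2.
  exists i; first by rewrite /i truncn_lt_nat// gtr_pMr// /x'; lra.
  exists x'; split; first by apply/to_circleE; exists (- Num.floor x); rewrite rmorphN.
  rewrite -(ler_pM2l m0R) -{1}(ger0_norm (ltW m0R)) -normrM mulrBr mulrCA.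
  rewrite !divff ?gt_eqF// mulr1.
  by rewrite -natr1 in i2; rewrite ler_norml; apply/andP; split; lra.
rewrite (torus_repr u); set x := repr u.1; set y := repr u.2.
have an0 : (0 < a * n)%N by rewrite muln_gt0.
have [i ia [x' [<- xi]]] := grid _ x an0.
have [j jb [y' [<- yj]]] := grid b y isT.
exists (pt (i, j)).
  by rewrite !inE; apply: map_f; apply/allpairsP; exists (i, j); rewrite !mem_iota.
apply/bowen_skew_le; first exact: ltW.
move=> k kn /=; set xg := _ / _ in xi *; set yg := _ / _ in yj *.
rewrite natrM invfM in xi.
have kn' : k%:R / n%:R <= 1 :> R by rewrite ler_pdivrMr// mul1r ler_nat ltnW.
have k0 : 0 <= k%:R :> R := ler0n _ _.
have kd : k%:R * `|x' - xg| <= a%:R^-1.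
  apply: (@le_trans _ _ (k%:R * (a%:R^-1 / n%:R))); first by rewrite ler_wpM2l.
  by rewrite mulrCA ger_pMr// invr_gt0.
split.
  apply: le_trans (nint_dist_le_norm _) _; apply: le_trans xi _; apply: le_trans a3.
  by rewrite ger_pMr ?invr_gt0// invf_le1// ler1n.
have := twist _ _ _ _ s0 (le_trans kd a1).
have lin : `|k%:R * l%:~R * (x' - xg)| <= eps / 4.
  rewrite !normrM (ger0_norm k0) mulrAC mulrC; apply: le_trans a2.
  by rewrite ler_wpM2l.
have := nint_dist_le_norm (y' + S k x' - (yg + S k xg)).
have := ler_normD (y' - yg) (S k x' - S k xg).
have := ler_normD (S k x' - S k xg - k%:R * l%:~R * (x' - xg)) (k%:R * l%:~R * (x' - xg)).
rewrite subrK (_ : y' - yg + _ = y' + S k x' - (yg + S k xg)); last ring.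
rewrite /s; lra.
Qed.

(** While two nearby orbits stay 2 eps-close modulo integers, their fibre
    distance cannot jump to another integer, so it is small as a real number; but
    the linear part n l |x - x'| dominates the remainder, which has the order of
    its square root. *)
Lemma skew_separation eps x x' n : l != 0 -> 0 < eps -> eps <= 512^-1 ->
  `|l%:~R| * eps <= 16^-1 ->
  `|x - x'| <= 2 * eps -> (forall k, (k < n)%N -> N (S k x - S k x') <= 2 * eps) ->
  n%:R * `|x - x'| < 7.
Proof.
move=> l0 e0 e1 le1 hx hN.
have step k : (k < n)%N -> `|S k x - S k x'| <= 2 * eps.
  elim: k => [|k IH] kn; first by rewrite !birkhoff0 subrr normr0; lra.
  have := hN _ kn; rewrite nint_dist_small//.
  have := IH (ltnW kn).
  have h16 : 0 < 16^-1 :> R by rewrite invr_gt0.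
  have := twist 1 (x + k%:R * alpha) (x' + k%:R * alpha) _ h16.
  rewrite !(birkhoffS _ _ k) !(birkhoffS _ _ 0) !birkhoff0 !add0r !mul0r !addr0 !mul1r.
  rewrite (_ : x + _ - (x' + _) = x - x'); last ring.
  have hsq : `|x - x'| <= 16^-1 ^+ 2 by rewrite exprVn -natrX; lra.
  move=> /(_ hsq) h1 h2.
  have h3 : `|l%:~R * (x - x')| <= 8^-1.
    by rewrite normrM; have := normr_ge0 (l%:~R : R); nra.
  move: h1 h2 h3; rewrite !ler_norml => /andP[? ?] /andP[? ?] /andP[? ?].
  by apply/andP; split; lra.
case: n hN step => [|n] hN step; first by rewrite mul0r.
suff : n%:R * `|x - x'| < 6 by rewrite -[n.+1%:R]natr1 mulrDl mul1r; lra.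
rewrite ltNge; apply/negP => D6.
set D := n%:R * `|x - x'| in D6.
have s0 : 0 < D * (41 / 100) by lra.
have hs : n%:R * `|x - x'| <= (D * (41 / 100)) ^+ 2 by rewrite -/D expr2; nra.
have := twist _ _ _ _ s0 hs; have := step n (ltnSn n).
have l1 : 1 <= `|l%:~R : R| by rewrite norm_intr_ge1 ?intr_int// intr_eq0.
have : D <= `|n%:R * l%:~R * (x - x')|.
  by rewrite !normrM (ger0_norm (ler0n _ _)) mulrAC -/D; nra.
have := ler_normB (S n x - S n x') (S n x - S n x' - n%:R * l%:~R * (x - x')).
rewrite opprB addrC subrK; lra.
Qed.

(** A point of a spanning set serves at most one point of a grid whose rows are more
    than 2 eps apart and whose columns are at least 7 / n apart (or reduce to one
    column, for n < 7). *)
Lemma span_card_skew_ge eps n : l != 0 -> 0 < eps -> eps <= 512^-1 ->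
  `|l%:~R| * eps <= 16^-1 -> (0 < n)%N ->
  (((84 * eps)^-1 * n%:R)%:E <= span_card T n eps)%E.
Proof.
move=> l0 e0 e1 le1 n0.
apply: le_ereal_inf_tmp => _ [F hF <-]; rewrite lee_fin.
pose I := maxn 1 (n %/ 7); pose J := Num.truncn (3 * eps)^-1.
have e3 : 0 < 3 * eps by lra.
have J0 : 0 <= (3 * eps)^-1 by rewrite invr_ge0 ltW.
have /andP[J1 J2] := truncn_itv J0; rewrite -/J in J1 J2; rewrite -[J.+1%:R]natr1 in J2.
have J3 : 3 <= (3 * eps)^-1 by rewrite -[leRHS]mul1r ler_pdivlMr//; lra.
have Jpos : 0 < J%:R :> R by lra.
have Jgap : 2 * eps < J%:R^-1.
  have : (3 * eps)^-1^-1 <= J%:R^-1 by rewrite lef_pV2 ?posrE// invr_gt0.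
  by rewrite invrK; lra.
have Jbig : (6 * eps)^-1 <= J%:R.
  rewrite (_ : 6 * eps = 2 * (3 * eps)); last ring.
  by rewrite invfM; lra.
have I0 : (0 < I)%N by rewrite leq_max.
have I0R : 0 < I%:R :> R by rewrite ltr0n.
have Ibig : n%:R <= 14 * I%:R :> R.
  by rewrite -natrM ler_nat /I; clear; lia.
pose x (i : nat) : R := i%:R / I%:R; pose y (j : nat) : R := j%:R / J%:R.
have sep (m i j : nat) : (i < m)%N -> (j < m)%N -> (0 < m)%N ->
    N (i%:R / m%:R - j%:R / m%:R) < m%:R^-1 :> R -> i = j.
  move=> im jm m0 h; have m0R : 0 < m%:R :> R by rewrite ltr0n.
  have [k hk] := nint_distP (i%:R / m%:R - j%:R / m%:R : R).
  move: h; rewrite hk -(ltr_pM2l m0R) divff ?gt_eqF// -{1}(ger0_norm (ltW m0R)) -normrM.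
  rewrite (_ : m%:R * _ = (i%:Z - j%:Z + k * m%:Z)%:~R); last first.
    by rewrite !(intrD, rmorphM, rmorphN) /=; field; exact: lt0r_neq0.
  rewrite -intr_norm ltrz1 => h.
  have e : (i%:Z - j%:Z + k * m%:Z = 0)%R by move: h; clear; lia.
  have [k0|[k1|k1]] : k = 0 \/ (1 <= k)%R \/ (k <= -1)%R by clear; lia.
  - by move: e; rewrite k0 mul0r; clear; lia.
  - have : (m%:Z <= k * m%:Z)%R by rewrite ler_peMl.
    by move: e im jm; clear; lia.
  - have : (k * m%:Z <= - m%:Z)%R by rewrite -mulN1r ler_wpM2r.
    by move: e im jm; clear; lia.
have /choice[w hw] : forall p : 'I_I * 'I_J, exists w : F,
    bowen_dist T n (C (x p.1), C (y p.2)) (val w) <= eps.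
  by move=> p; have [w wF hw] := hF (C (x p.1), C (y p.2)); exists [` wF]%fset.
have inj : injective w.
  move=> [i j] [i' j'] ww.
  have h (p : 'I_I * 'I_J) : forall k, (k < n)%N ->
     N (x p.1 - repr (val (w p)).1) <= eps /\
     N (y p.2 + S k (x p.1) - (repr (val (w p)).2 + S k (repr (val (w p)).1))) <= eps.
    by apply/bowen_skew_le; [exact: ltW|rewrite -torus_repr; exact: hw].
  have H k : (k < n)%N -> N (x i - x i') <= 2 * eps /\
      N (y j + S k (x i) - (y j' + S k (x i'))) <= 2 * eps.
    move=> kn; have [h1 h2] := h (i, j) k kn; have [h3 h4] := h (i', j') k kn.
    rewrite /= in h1 h2 h3 h4; rewrite -ww in h3 h4; move: h1 h2 h3 h4.
    set u := repr _; set v := repr _ => h1 h2 h3 h4; split.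
      have := nint_distD (x i - u) (- (x i' - u)); rewrite nint_distN.
      by rewrite (_ : _ + - _ = x i - x i'); [lra|ring].
    have := nint_distD (y j + S k (x i) - (v + S k u)) (- (y j' + S k (x i') - (v + S k u))).
    by rewrite nint_distN (_ : _ + - _ = y j + S k (x i) - (y j' + S k (x i'))); [lra|ring].
  have jj : j = j' :> nat.
    have [_] := H 0%N n0; rewrite !birkhoff0 !addr0 => h'.
    by apply: (sep J) => //; [by rewrite -(ltr_nat R)|exact: le_lt_trans h' Jgap].
  have ii : i = i' :> nat.
    have [n7|n7] := ltnP n 7.
      have I1 : I = 1%N by rewrite /I divn_small.
      have := ltn_ord i; have := ltn_ord i'; rewrite {2 4}I1.
      by case: (val i) (val i') => [|?] [|?].
    apply: (sep I) => //; have [m hm] := nint_distP (x i - x i').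
    rewrite hm; have [hx _] := H 0%N n0.
    have : n%:R * `|(x i + m%:~R) - x i'| < 7.
      apply: (skew_separation eps) => //; first by rewrite addrAC -hm.
      move=> k kn; have [_] := H k kn; rewrite jj.
      have [c' ->] := @birkhoff_int _ alpha _ _ hf k (x i) m.
      rewrite (_ : _ + _ - _ = S k (x i) - S k (x i')); last ring.
      by rewrite [S k (x i) + _ - _]addrAC nint_distD_int.
    rewrite addrAC; set D := `|_|; have D0 : 0 <= D by rewrite normr_ge0.
    have In : 7 * I%:R <= n%:R :> R.
      by rewrite -natrM ler_nat /I (maxn_idPr _) ?divn_gt0// mulnC leq_trunc_div.
    by move=> hD; rewrite -(ltr_pM2l I0R) divff ?gt_eqF//; nra.
  by congr pair; apply: val_inj.
have := leq_card w inj; rewrite card_prod !card_ord -cardfE => cF.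
apply: (@le_trans _ _ (I%:R * J%:R)); last by rewrite -natrM ler_nat.
rewrite (_ : 84 * eps = 14 * (6 * eps)); last ring.
rewrite invfM; have p6 : 0 < (6 * eps)^-1 by rewrite invr_gt0; lra.
by nra.
Qed.

End Complexity.

Theorem theoremC (R : realType) (l : int) (alpha : R)
  (l_neq0 : l <> 0)
  (alpha_irrational : irrational alpha)
  (alpha_liminf : diophantine_liminf (2 * pi * alpha) = 0%E) :
  exists (f : R -> R) (hf : calF l f),
    let T := skew_homeo alpha hf in
    [/\ minimal T,
        distal T,
        ~ system_of_order R 2 T
      & exists (eps0 : R) (c1 c2 : R -> R),
          [/\ 0 < eps0,
              (forall eps : R, 0 < eps -> eps < eps0 ->
                 [/\ 0 < c1 eps,
                     0 < c2 eps
                   & forall n : nat, (1 <= n)%N ->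
                       ((c1 eps * n%:R)%:E <= span_card T n eps)%E /\
                       (span_card T n eps <= (c2 eps * n%:R)%:E)%E])
            & c1 eps @[eps --> 0^'+] --> +oo]].
Proof.
have l0 : l != 0 by apply/eqP.
have [q hq] := resonant_sequence_exists R alpha alpha_irrational.
exists (@twisted R alpha q l), (twisted_calF hq l) => T.
have twist n x y s : 0 < s -> n%:R * `|x - y| <= s ^+ 2 ->
    `|birkhoff alpha (@twisted R alpha q l) n x
      - birkhoff alpha (@twisted R alpha q l) n y - n%:R * l%:~R * (x - y)| <= 2 * s.
  move=> s0 hs; rewrite birkhoff_twisted addrAC subrr add0r.
  exact: birkhoff_phi_holder hq _ _ _ _ s0 hs.
split.
- exact: skew_minimal.
- exact: skew_distal.
- exact: twisted_not_order2.
have /choice[c2 hc2] : forall eps : R, exists c : R, 0 < eps ->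
    0 < c /\ forall n, (0 < n)%N -> (span_card T n eps <= (c * n%:R)%:E)%E.
  move=> eps; have [e0|e0] := ltP 0 eps; last by exists 0.
  by have [c c0 hc] := span_card_skew_le (twisted_calF hq l) twist eps e0; exists c.
pose L : R := `|l%:~R|; have L0 : 0 <= L by rewrite normr_ge0.
have L1 : 0 < 512 * (L + 1) by lra.
exists (512 * (L + 1))^-1, (fun eps => (84 * eps)^-1), c2; split.
- by rewrite invr_gt0.
- move=> eps e0 e1; have [c20 hc] := hc2 eps e0.
  have eL : eps * (512 * (L + 1)) < 1 by rewrite -ltr_pdivlMr// mul1r.
  split=> [|//|n n0]; first by rewrite invr_gt0 mulr_gt0.
  split; last exact: hc.
  by apply: span_card_skew_ge => //; [nra|rewrite -/L; nra].
apply/cvgryPge => A; near=> eps.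
have e0 : 0 < eps by near: eps; exact: nbhs_right_gt.
have A0 : 0 < `|A| + 1 by rewrite ltr_wpDl.
have eA : eps < (84 * (`|A| + 1))^-1.
  by near: eps; apply: nbhs_right_lt; rewrite invr_gt0 mulr_gt0.
apply: le_trans (ler_norm A) _; rewrite -[leRHS]mul1r ler_pdivlMr ?mulr_gt0//.
move: eA; rewrite -[X in _ < X]mul1r ltr_pdivlMr ?mulr_gt0//; nra.
Unshelve. all: by end_near. Qed.
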